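(* Let $n\ge3$ and let $\lambda=(\lambda_1,\lambda_2)$ be a partition of $n$ with $\lambda_1>\lambda_2\ge1$. Let $\Gamma,\Gamma'$ be (reduced) nb-admissible $\overline{\mathcal S_n}$-graphs such that $U(\Gamma)\simeq U(\Gamma')\simeq\overline{\mathcal D}_\lambda$. Then $\Gamma\simeq\Gamma'$ as $\overline{\mathcal S_n}$-graphs. As a result, they are also isomorphic to $\overline\Gamma_\lambda$.
   Context: **Residues and cyclic intervals.** For $k\in\mathbb Z$, $\overline{k}$ is the unique element of $\{1,\dots,n\}$ congruent to $k$ modulo $n$; $[a,b]=\{x\in\mathbb Z\mid a\le x\le b\}$. For $a,b\in\{1,\dots,n\}$, $\langle a,b\rangle\subset\{1,\dots,n\}$ is $\emptyset$ if $a=\overline{b+1}$, and otherwise is the cyclic interval $\{a,\overline{a+1},\dots,b\}$. **Groups.** $\overline{\mathcal S_n}$ is the affine symmetric group, a Coxeter group with simple reflections $s_0=s_n,s_1,\dots,s_{n-1}$ whose Dynkin diagram is the cycle of type $\widetilde A_{n-1}$. Simple reflections are identified with $[1,n]$ via $s_i\leftrightarrow i$. **Tableaux.** $\mathrm{RSYT}(\lambda)$ is the set of fillings of the Young diagram of $\lambda$ (English convention) by $1,\dots,n$, each used once, with rows increasing; $T^1$ (top row) and $T^2$ are the rows of $T$, regarded as sets. Whenever entries are interchanged, rows are re-sorted. $\overline{\mathrm{des}}(T)=\{i\in[1,n]\mid i\text{ lies in a strictly higher row of }T\text{ than }\overline{i+1}\}$. $T,T'\in\mathrm{RSYT}(\lambda)$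 are connected by a Knuth move if $\overline{\mathrm{des}}(T),\overline{\mathrm{des}}(T')$ are incomparable under inclusion and $T'$ is obtained from $T$ by interchanging $\overline i$ and $\overline{i+1}$ for some $i$. **Labeled graphs and $W$-graphs.** For a Coxeter group $W$ with simple reflections $I$, an $I$-labeled graph $(V,m,\tau)$ consists of a set $V$, maps $m:V\times V\to\mathbb Z[q^{\pm1/2}]$ (written $m(u\triangleright v)$) and $\tau:V\to\{\text{subsets of }I\}$, such that for each $v$ only finitely many $w$ have $m(v\triangleright w)\ne0$ or $m(w\triangleright v)\neq0$. It is reduced if $m(u\triangleright v)=0$ whenever $\tau(u)\subset\tau(v)$. It is nb-admissible if all $m(u\triangleright v)\in\mathbb N=\{0,1,2,\dots\}$ and $m(u\triangleright v)=m(v\triangleright u)$ whenever $\tau(u),\tau(v)$ are incomparable. Isomorphisms are bijections of vertices preserving $m$ and $\tau$. Let $\mathcal H_W$ be the Iwahori–Hecke algebra over $\mathbb Z[q^{\pm1/2}]$ with generators $T_i$ ($i\in I$) satisfying the braid relations and $(T_i-q)(T_i+1)=0$. The graph is a $W$-graph if the formulas $T_i(u)=qu$ if $i\notin\tau(u)$, and $T_i(u)=-u+q^{1/2}\sum_{v:\,i\notin\tau(v)}m(u\triangleright v)\,v$ if $i\in\tau(u)$, define an $\mathcal H_W$-module structure on $\bigoplus_{v\in V}\mathbb Z[q^{\pm1/2}]v$. The simple underlying graph $U(\Gamma)$ has the same $V,\tau$, and weight $m'$ with $m'(u\triangleright v)=m'(v\triangleright u)=1$ if $m(u\triangleright v)=m(v\triangleright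 u)=1$, and $m'(u\triangleright v)=m'(v\triangleright u)=0$ otherwise. **The graph $\overline{\mathcal D}_\lambda$.** It is the $[1,n]$-labeled graph with vertex set $\mathrm{RSYT}(\lambda)$, $\tau=\overline{\mathrm{des}}$, and $m(u\triangleright v)=m(v\triangleright u)=1$ if $u,v$ are connected by a Knuth move, $0$ otherwise. **The graph $\overline\Gamma_\lambda$.** Its vertex set is $\mathrm{RSYT}(\lambda)$, $\tau=\overline{\mathrm{des}}$, and $m(s\triangleright t)\in\{0,1\}$ with $m(s\triangleright t)=1$ iff there is a move from $s$ to $t$ of one of the following kinds. 1. (First kind) $t$ is obtained from $s$ by interchanging $\overline i$ and $\overline{i+1}$, where $\overline i\in s^1$ and $\overline{i+1}\in s^2$. 2. (Second kind) $t$ is obtained from $s$ by interchanging $\overline i$ and $\overline j$, where $\overline i\in s^2$, $\overline j\in s^1$, $\overline i\ne\overline{j+1}$, and: (a) $\overline{j-i}$ is odd; (b) $\overline{i+1}\in s^1$ and $\overline{j-1}\in s^2$; (c) $\overline{i-1}\in s^1$ or $\overline{j+1}\in s^2$; (d) $\#(s^2\cap\langle\overline{j-1-2k},\overline{j-2}\rangle)\ge k$ for all $k\in\{1,\dots,\frac{\overline{j-i}-3}{2}\}$; (e) $\#(s^2\cap\langle\overline{i+2},\overline{j-2}\rangle)=\frac{\overline{j-i}-3}{2}$ when $\overline j\ne\overline{i+1}$. *)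

(* Defs.v *)
From HB Require Import structures.
From mathcomp Require Import all_boot all_order perm all_algebra.
From mathcomp Require Import boolp classical_sets functions cardinality fsbigop.
From mathcomp Require Import finmap monalg.

Set Implicit Arguments.
Unset Strict Implicit.
Unset Printing Implicit Defensive.

Import GRing.Theory.
Local Open Scope ring_scope.

Local Notation "x %:F" := (tofrac x).

(* Laurent polynomials over Z in the indeterminate 'X, which stands for
   q^{1/2}, as a subring of the field of fractions of Z['X]. *)
Definition laurent_pred : {pred {fraction {poly int}}} :=
  fun x => `[< exists (p : {poly int}) (k : nat), x * ('X^k)%:F = p%:F >].

Lemma laurent_subring : subring_closed laurent_pred.
Proof.
split=> [|x y|x y]; rewrite ?unfold_in.
- by apply/asboolP; exists 1, 0%N; rewrite expr0 mul1r.
- move=> /asboolP[p [k xE]] /asboolP[r [l yE]]; apply/asboolP.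
  exists (p * 'X^l - r * 'X^k), (k + l)%N.
  rewrite exprD rmorphM rmorphB !rmorphM /= -xE -yE mulrBl !mulrA; congr (_ - _).
  by rewrite -!mulrA [X in y * X]mulrC.
- move=> /asboolP[p [k xE]] /asboolP[r [l yE]]; apply/asboolP.
  exists (p * r), (k + l)%N.
  by rewrite exprD !rmorphM /= -xE -yE mulrACA.
Qed.

HB.instance Definition _ :=
  GRing.isSubringClosed.Build {fraction {poly int}} laurent_pred laurent_subring.

Record laurent : predArgType := Laurent {
  laurent_val : {fraction {poly int}};
  laurent_valP : laurent_val \in laurent_pred }.

HB.instance Definition _ := [isSub for laurent_val].
HB.instance Definition _ := [Choice of laurent by <:].
HB.instance Definition _ := [SubChoice_isSubComNzRing of laurent by <:].

Lemma qhalf_subproof : ('X%:F : {fraction {poly int}}) \in laurent_pred.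
Proof.
by rewrite unfold_in; apply/asboolP; exists 'X, 0%N; rewrite expr0 mulr1.
Qed.

Definition qhalf : laurent := Laurent qhalf_subproof.
Definition q : laurent := qhalf ^+ 2.

(* [f (g (f ( ... x)))], with [k] applications in total. *)
Fixpoint alternate (M : Type) (k : nat) (f g : M -> M) (x : M) : M :=
  if k is k'.+1 then f (alternate k' g f x) else x.

(* The Hecke algebra is given by generators and relations, so a module over it
   is a [laurent]-module with linear operators [T i] satisfying the relations.
   In the Coxeter matrix [cox], the value [0] encodes an infinite order (no
   braid relation). *)
Definition hecke_module (I : finType) (cox : I -> I -> nat)
    (M : lmodType laurent) (T : I -> M -> M) : Prop :=
  [/\ forall i, linear (T i),
      forall i x, T i (T i x + x) - q *: (T i x + x) = 0
    & forall i j x, i != j ->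
        alternate (cox i j) (T i) (T j) x = alternate (cox i j) (T j) (T i) x].

Record lgraph (I : finType) := LGraph {
  vertex : choiceType;
  weight : vertex -> vertex -> laurent;
  tau : vertex -> {set I};
  weight_fin : forall v,
    finite_set [set w | weight v w != 0 \/ weight w v != 0]%classic }.

Section LabeledGraphs.
Variable I : finType.
Implicit Types G H : lgraph I.

Definition reduced G : Prop :=
  forall u v : vertex G, tau u \subset tau v -> weight u v = 0.

Definition nb_admissible G : Prop :=
  (forall u v : vertex G, exists k : nat, weight u v = k%:R) /\
  (forall u v : vertex G,
     ~~ (tau u \subset tau v) -> ~~ (tau v \subset tau u) ->
     weight u v = weight v u).

Definition lgraph_iso G H : Prop :=
  exists f : vertex G -> vertex H,
    [/\ bijective f,
        forall u v, weight (f u) (f v) = weight u v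
      & forall u, tau (f u) = tau u].

Definition wgraph_module G : lmodType laurent := {malg laurent[vertex G]}.

Definition wgraph_basis G (u : vertex G) : wgraph_module G := mkmalgU u 1.

(* The sum ranges over the finitely many [v] with a nonzero term. *)
Definition wgraph_gen G (i : I) (u : vertex G) : wgraph_module G :=
  if i \in tau u then
    - wgraph_basis u + qhalf *:
      \sum_(v \in [set v | i \notin tau v]%classic)
        weight u v *: wgraph_basis v
  else q *: wgraph_basis u.

Definition wgraph_op G (i : I) (x : wgraph_module G) : wgraph_module G :=
  \sum_(u <- msupp x) mcoeff u x *: wgraph_gen i u.

Definition is_wgraph (cox : I -> I -> nat) G : Prop :=
  hecke_module cox (@wgraph_op G).

Definition simple_weight G (u v : vertex G) : laurent :=
  ((weight u v == 1) && (weight v u == 1))%:R.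

Lemma simple_weight_fin G (v : vertex G) :
  finite_set [set w | simple_weight v w != 0 \/ simple_weight w v != 0]%classic.
Proof.
have bool_neq0 (b : bool) : (b%:R : laurent) != 0 -> b.
  by case: b => //; rewrite mulr0n eqxx.
apply: sub_finite_set (weight_fin v) => w /= vw.
suff /eqP-> : weight v w == 1 by left; exact: oner_neq0.
by case: vw => /bool_neq0 /andP[].
Qed.

Definition simple_graph G : lgraph I := LGraph (@tau I G) (@simple_weight_fin G).

End LabeledGraphs.

Local Open Scope nat_scope.

(* The ordinal [i : 'I_n] stands for the residue (letter, simple reflection)
   [i + 1] of [{1, ..., n}]; thus [ordS] and [ord_pred] are the cyclic successor
   and predecessor, and the order on letters is the order on ordinals. *)

(* Coxeter matrix of the cycle of type affine A_{n-1}, meant for [n >= 3]. *)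
Definition affA_cox (n : nat) (i j : 'I_n) : nat :=
  if i == j then 1 else
  if (j == ordS i) || (i == ordS j) then 3 else 2.

Section RSYT.
Variables n l1 l2 : nat.
Implicit Types i j a b x : 'I_n.

Definition rsyt_pred (t : l1.-tuple 'I_n * l2.-tuple 'I_n) : bool :=
  [&& sorted (fun a b => a < b) t.1, sorted (fun a b => a < b) t.2
    & perm_eq (t.1 ++ t.2) (enum 'I_n)].

Record rsyt : predArgType := Rsyt {
  rows : l1.-tuple 'I_n * l2.-tuple 'I_n;
  rowsP : rsyt_pred rows }.

HB.instance Definition _ := [isSub for rows].
HB.instance Definition _ := [Finite of rsyt by <:].

Implicit Types s t : rsyt.

Definition row1 t : {set 'I_n} := [set x in (rows t).1].
Definition row2 t : {set 'I_n} := [set x in (rows t).2].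

Definition interchanged a b s t : bool :=
  let resort r := sort (fun x y : 'I_n => x <= y) (map (tperm a b) r) in
  (resort (rows s).1 == (rows t).1 :> seq _) &&
  (resort (rows s).2 == (rows t).2 :> seq _).

Definition cdes t : {set 'I_n} :=
  [set i | (i \in row1 t) && (ordS i \in row2 t)].

Definition knuth_move s t : bool :=
  [&& ~~ (cdes s \subset cdes t), ~~ (cdes t \subset cdes s)
    & [exists i, interchanged i (ordS i) s t]].

(* The representative of [b - a] in [{1, ..., n}]. *)
Definition cdiff b a : nat := if a < b then b - a else b + n - a.

(* Walking up cyclically from [a], one meets [x] no later than [b]. *)
Definition cint a b : {set 'I_n} :=
  if a == ordS b then finset.set0
  else [set x | cdiff x a %% n <= cdiff b a %% n].

Definition first_move s t : bool :=
  [exists i, [&& i \in row1 s, ordS i \in row2 s & interchanged i (ordS i) s t]].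

(* Natural-number subtraction is harmless in [(cdiff j i - 3)./2]: when
   [cdiff j i = 1], the range of [k] is empty and the last condition is void. *)
Definition second_move_at i j s : bool :=
  [&& [&& i \in row2 s, j \in row1 s & i != ordS j],
      odd (cdiff j i),
      (ordS i \in row1 s) && (ord_pred j \in row2 s),
      (ord_pred i \in row1 s) || (ordS j \in row2 s),
      all (fun k : nat =>
             k <= #|row2 s :&: cint (iter (1 + 2 * k) (@ord_pred n) j)
                                    (iter 2 (@ord_pred n) j)|)
          (iota 1 ((cdiff j i - 3)./2))
    & (j != ordS i) ==>
        (#|row2 s :&: cint (iter 2 (@ordS n) i) (iter 2 (@ord_pred n) j)|
           == (cdiff j i - 3)./2)].

Definition second_move s t : bool :=
  [exists i, exists j, second_move_at i j s && interchanged i j s t].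

Lemma rsyt_fin (P : set rsyt) : finite_set P.
Proof. exact: finite_finset. Qed.

Definition knuth_graph : lgraph 'I_n :=
  @LGraph 'I_n rsyt (fun s t => (knuth_move s t)%:R%R) cdes (fun=> rsyt_fin _).

Definition move_graph : lgraph 'I_n :=
  @LGraph 'I_n rsyt (fun s t => (first_move s t || second_move s t)%:R%R) cdes
    (fun=> rsyt_fin _).

End RSYT.

(* Main.v *)
From mathcomp Require Import boolp classical_sets fsbigop.
From mathcomp Require Import finmap monalg.
From mathcomp Require Import all_boot perm all_algebra.
From mathcomp Require Import zify ring.
Require Import Defs.

(** Read a tableau around the circle as a word in [false] (first row, an opening
parenthesis) and [true] (second row, a closing parenthesis), so that [tau] records the
occurrences of [false; true], called cups.  As [tau] never contains two
neighbours, the operators [T_i - q] satisfy the Temperley-Lieb relations; in the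
dual module they send a tableau [v] with [i] not in [tau v] to
[F_i v = \sum_(u | i \in tau u) m(u > v) u], up to scaling by [q^(1/2)].  If a
neighbour of [i] lies in [tau v], positivity of the weights forces [F_i v] to be a
single tableau, the Knuth neighbour of [v], in which a cup has moved past one letter.
If not, the commutation relations let one slide all cups away from the positions
[i, i+1] without changing the problem.  Either the letter matched with one of these two
positions becomes adjacent to them, which is the Knuth case, or the word becomes
unnested, and then [F_i v = 0] because [tau] of a term of [F_i v] would have more than
[l2] elements.  The resulting values of [F_i v] are the moves of the first and second
kind. *)

Set Implicit Arguments.
Unset Strict Implicit.
Unset Printing Implicit Defensive.

Import GRing.Theory.

(** * Dyck words *)

Section Dyck.
Implicit Types (p q D S R : seq bool) (h : nat).

(** Generation by inserting a cup anywhere, rather than by first return, makes induction on [dyck]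
    remove one cup at a time. This is the form that the sliding argument needs. *)
Inductive dyck : seq bool -> Prop :=
| dyck_nil : dyck [::]
| dyck_insert p q : dyck (p ++ q) -> dyck (p ++ [:: false, true & q]).

(** [None] records a height that would become negative, that is, a closing letter left unmatched
    even after [h] opening letters are put in front. *)
Fixpoint height_from h D : option nat :=
  match D, h with
  | [::], _ => Some h
  | false :: D', _ => height_from h.+1 D'
  | true :: D', h'.+1 => height_from h' D'
  | true :: _, 0 => None
  end.

Lemma height_from_insert h p q :
  height_from h (p ++ [:: false, true & q]) = height_from h (p ++ q).
Proof. by elim: p h => [|[] p IH] [|h] //=. Qed.

Lemma height_from_count h D k : height_from h D = Some k ->
  h + count negb D = k + count id D.
Proof.
by elim: D h => [|[] D IH] [|h] //=; try (by case=> <-); move=> /IH; lia.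
Qed.

(** The first closing letter of [D] has an opening letter just before it, possibly the [false] put
    in front. *)
Lemma cup_factor D : true \in D -> exists p q, false :: D = p ++ [:: false, true & q].
Proof.
elim: D => [//|[] D IH]; first by exists [::], D.
by rewrite inE /= => /IH[p [q ->]]; exists (false :: p), q.
Qed.

(** Induction on the length: a nonempty word of this kind starts with an opening letter, contains a
    closing one by counting, hence a cup, and deleting the cup does not change the final height. *)
Lemma dyck_height D : height_from 0 D = Some 0 -> dyck D.
Proof.
have [k] := ubnP (size D); elim: k D => [//|k IH] [|[] D] //= Dk H; first exact: dyck_nil.
have [p [q E]] : exists p q, false :: D = p ++ [:: false, true & q].
  apply: cup_factor; have := height_from_count H.
  have -> : (true \in D) = has id D by rewrite -has_pred1; apply: eq_has; case.
  by rewrite has_count; lia.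
rewrite E; apply: dyck_insert; apply: IH.
  by move: Dk; have := congr1 size E; rewrite /= !size_cat /=; lia.
by rewrite -height_from_insert -E.
Qed.

(** For [h = 0], the [true] after [D] is the partner of an opening letter placed in front of [R];
    the second alternative says that such a letter has no partner in [R]. *)
Lemma first_return h R :
  (exists D S, R = D ++ true :: S /\ height_from h D = Some 0) \/ height_from h R.
Proof.
elim: R h => [|[] R IH] [|h] /=; try by right.
- by left; exists [::], R.
- by case: (IH h) => [[D [S [-> HD]]]|]; [left; exists (true :: D), S|right].
- by case: (IH 1) => [[D [S [-> HD]]]|]; [left; exists (false :: D), S|right].
- by case: (IH h.+2) => [[D [S [-> HD]]]|]; [left; exists (false :: D), S|right].
Qed.

(** The mirror image of a parenthesis word. It exchanges prefixes with suffixes, and partners to the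
    right with partners to the left. *)
Definition flip D := rev (map negb D).

Lemma flip_cat p q : flip (p ++ q) = flip q ++ flip p.
Proof. by rewrite /flip map_cat rev_cat. Qed.

Lemma flipK : involutive flip.
Proof. by move=> D; rewrite /flip map_rev revK mapK //; exact: negbK. Qed.

Lemma count_flip D : count id (flip D) = count negb D.
Proof. by rewrite count_rev count_map. Qed.

Lemma countN_flip D : count negb (flip D) = count id D.
Proof. by rewrite count_rev count_map; apply: eq_count => b; exact: negbK. Qed.

Lemma dyck_flip D : dyck D -> dyck (flip D).
Proof.
elim=> [|p q _]; first exact: dyck_nil.
rewrite !flip_cat => /dyck_insert; rewrite -[[:: _, _ & q]]/([:: false; true] ++ q) flip_cat -catA.
exact.
Qed.

(** In the mirror image closing letters outnumber opening ones, so the height becomes negative and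
    [first_return] isolates the first unmatched closing letter. *)
Lemma last_unmatched R : count id R < count negb R ->
  exists S D, R = S ++ false :: D /\ dyck D.
Proof.
move=> cR; case: (first_return 0 (flip R)) => [[D [S [RE HD]]]|].
  exists (flip S), (flip D); split; last exact/dyck_flip/dyck_height.
  by rewrite -[R]flipK RE flip_cat -[_ :: S]cat1s flip_cat -catA.
case E: height_from => [k|//] _; have := height_from_count E.
by rewrite count_flip countN_flip; lia.
Qed.

Lemma dyck_size D : dyck D -> size D = (count id D).*2.
Proof. by elim=> [//|p q _]; rewrite !size_cat !count_cat /=; lia. Qed.

(** A suffix contains an inserted cup entirely, only its closing letter, or nothing of it; in no
    case does this create a surplus of opening letters. *)
Lemma dyck_suffix D k : dyck D -> size (drop k D) <= (count id (drop k D)).*2.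
Proof.
move=> dD; elim: dD k => [|p q _ IH] k; first by rewrite drop_oversize.
have [kp|pk] := leqP k (size p).
  have := IH k; rewrite !drop_cat ltn_neqAle kp andbT; case: eqP => [->|_] /=.
    by rewrite subnn !drop0 /=; lia.
  by rewrite !size_cat !count_cat /=; lia.
rewrite drop_cat ltnNge (ltnW pk) /=; case: (k - size p) (subn_gt0 (size p) k) => [|j].
  by rewrite pk.
move=> _; case: j => [|j] /=.
  have := IH (size p); rewrite drop_size_cat //= ?drop0; lia.
by have := IH (j + size p); rewrite -drop_drop drop_size_cat.
Qed.

Lemma height_from_suffix h D : (forall k, count id (take k D) <= h + count negb (take k D)) ->
  height_from h D = Some (h + count negb D - count id D).
Proof.
elim: D h => [|b D IH] h H /=; first by rewrite subn0 addn0.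
case: b H => /= H.
  case: h H => [|h] H; first by have := H 1; rewrite /= take0.
  rewrite IH => [|k]; last by have := H k.+1; rewrite /=; lia.
  by congr Some; lia.
rewrite IH => [|k]; last by have := H k.+1; rewrite /=; lia.
by congr Some; lia.
Qed.

(** The counting conditions on moves of the second kind concern suffixes, whereas [height_from] sees
    prefixes; [flip] passes from one to the other. *)
Lemma dyck_of_suffixes D : size D = (count id D).*2 ->
  (forall k, size (drop k D) <= (count id (drop k D)).*2) -> dyck D.
Proof.
have cnt s : count negb s = size s - count id s.
  by have := count_predC id s; rewrite -[count (predC id) s]/(count negb s); lia.
move=> sD H; rewrite -[D]flipK; apply/dyck_flip/dyck_height.
rewrite height_from_suffix; last first.
  move=> k; have -> : take k (flip D) = flip (drop (size D - k) D).
    by rewrite /flip take_rev size_map map_drop.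
  move: (_ - _) => j; rewrite count_flip countN_flip cnt add0n.
  by have := H j; have := count_size id (drop j D); lia.
by rewrite count_flip countN_flip cnt sD; congr Some; lia.
Qed.

End Dyck.

(** * Cyclic words and two-row tableaux *)

Lemma mem_imset_tperm (T : finType) (a b x : T) (A : {set T}) :
  (x \in tperm a b @: A) = (tperm a b x \in A).
Proof. by rewrite -{1}(tpermK a b x) mem_imset //; exact: perm_inj. Qed.

Section CyclicWords.
Variable n : nat.
Implicit Types (c : 'I_n) (S : {set 'I_n}) (w : seq bool).

Lemma val_iter_ordS k c : iter k (@ordS n) c = (c + k) %% n :> nat.
Proof.
elim: k => [|k IH] /=; first by rewrite addn0 modn_small.
by rewrite IH -addn1 modnDml addn1 addnS.
Qed.

Lemma iter_ordS_n c : iter n (@ordS n) c = c.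
Proof. by apply: val_inj; rewrite /= val_iter_ordS modnDr modn_small. Qed.

Lemma iter_ordS_inj c j k : j < n -> k < n ->
  iter j (@ordS n) c = iter k (@ordS n) c -> j = k.
Proof.
move=> jn kn /(congr1 val) /=; rewrite !val_iter_ordS => /eqP.
by rewrite eqn_modDl !modn_small // => /eqP.
Qed.

Lemma iter_ordS_surj c (x : 'I_n) : exists2 k, k < n & x = iter k (@ordS n) c.
Proof.
have n0 : 0 < n by case: x => x; case: n.
exists ((x + (n - c)) %% n); first by rewrite ltn_mod.
apply: val_inj; rewrite /= val_iter_ordS modnDmr addnCA subnKC ?modnDr ?modn_small //.
exact: ltnW.
Qed.

Definition word S c : seq bool := mkseq (fun k => iter k (@ordS n) c \in S) n.

Lemma size_word S c : size (word S c) = n.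
Proof. exact: size_mkseq. Qed.

Lemma nth_word S c k : k < n -> nth false (word S c) k = (iter k (@ordS n) c \in S).
Proof. exact: nth_mkseq. Qed.

Lemma word_rot S c k : k <= n -> word S (iter k (@ordS n) c) = rot k (word S c).
Proof.
move=> kn; have iota_shift a b : iota a b = map (addn a) (iota 0 b) by rewrite -iotaDl addn0.
rewrite /rot /word /mkseq -map_drop -map_take drop_iota take_iota.
rewrite (minn_idPl kn) -map_cat add0n.
have -> : iota 0 n = iota 0 (n - k) ++ iota (n - k) k by rewrite -{1}(subnK kn) iotaD.
rewrite !map_cat; congr (_ ++ _).
  rewrite (iota_shift k) -map_comp; apply: eq_map => a /=.
  by rewrite addnC iterD.
rewrite (iota_shift (n - k)) -map_comp; apply: eq_map => a /=.
by rewrite -iterD addnAC subnK // addnC iterD iter_ordS_n.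
Qed.

Lemma word_shift S c u v : word S c = u ++ v ->
  word S (iter (size u) (@ordS n) c) = v ++ u.
Proof.
move=> E; have := size_word S c; rewrite E size_cat => un.
by rewrite word_rot ?E ?rot_size_cat // -un leq_addr.
Qed.

Lemma count_word S c : count id (word S c) = #|S|.
Proof.
rewrite /word /mkseq count_map.
have -> : count (preim (fun k => iter k (@ordS n) c \in S) id) (iota 0 n) =
    count (mem S) [seq iter k (@ordS n) c | k <- iota 0 n] by rewrite count_map.
rewrite cardE /enum_mem -enumT size_filter; apply/seq.permP/uniq_perm.
- rewrite map_inj_in_uniq ?iota_uniq // => j k; rewrite !mem_iota !add0n /=.
  exact: iter_ordS_inj.
- exact: enum_uniq.
move=> x; rewrite mem_enum inE; apply/mapP.
by have [k kn ->] := iter_ordS_surj c x; exists k; rewrite // mem_iota.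
Qed.

Lemma word_inj S S' c : word S c = word S' c -> S = S'.
Proof.
move=> E; apply/setP => x; have [k kn ->] := iter_ordS_surj c x.
by rewrite -!nth_word // E.
Qed.

Lemma word_exists w c : size w = n -> exists S, word S c = w.
Proof.
move=> wn; exists [set iter k (@ordS n) c | k : 'I_n & nth false w k].
apply: (eq_from_nth (x0 := false)); rewrite size_word ?wn // => k kn.
rewrite nth_word //; apply/imsetP/idP => [[j + /(iter_ordS_inj kn (ltn_ord j)) ->]|wk].
  by rewrite inE.
by exists (Ordinal kn); rewrite ?inE.
Qed.

Lemma word_tperm S c a B b C : word S c = a :: B ++ b :: C ->
  word (tperm c (iter (size B).+1 (@ordS n) c) @: S) c = b :: B ++ a :: C.
Proof.
move=> E; have szn : (size B + (size C).+1).+1 = n.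
  by rewrite -(size_word S c) E /= size_cat.
set d := iter (size B).+1 (@ordS n) c.
have dE : (d \in S) = b.
  by rewrite -nth_word; [rewrite E /= nth_cat ltnn subnn|lia].
have cE : (c \in S) = a.
  by rewrite -[c]/(iter 0 (@ordS n) c) -nth_word; [rewrite E|lia].
apply: (eq_from_nth (x0 := false)); first by rewrite size_word /= size_cat /=.
rewrite size_word => k kn; rewrite nth_word // mem_imset_tperm.
case: tpermP => [kc|kd|/eqP kc /eqP kd].
- have -> : k = 0 by apply: (@iter_ordS_inj c) => //; lia.
  by [].
- have -> : k = (size B).+1 by apply: (@iter_ordS_inj c) => //; lia.
  by rewrite /= nth_cat ltnn subnn.
rewrite -nth_word // E; case: k kn kc kd => [|k] kn kc kd; first by rewrite eqxx in kc.
rewrite /= !nth_cat; case: ltngtP => // [Bk|kB]; last by rewrite /d kB eqxx in kd.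
by case: (k - size B) (subn_gt0 (size B) k) => [|a']; rewrite ?Bk.
Qed.

End CyclicWords.

Section Tableaux.
Variables n l1 l2 : nat.
Hypothesis l12n : l1 + l2 = n.
Local Notation rsyt := (rsyt n l1 l2).
Implicit Types (s t : rsyt) (c : 'I_n).

Lemma row1E t : row1 t = ~: row2 t.
Proof.
case: t => -[r1 r2] P; case/and3P: (P) => /= _ _ p.
apply/setP => x; rewrite !inE /=.
have := perm_mem p x; have : uniq (r1 ++ r2) by rewrite (perm_uniq p) enum_uniq.
rewrite cat_uniq mem_cat mem_enum inE => /and3P[_ /hasPn r21 _].
case: (boolP (x \in val r2)) => [/r21 /negPf -> //|_ ]; by rewrite orbF.
Qed.

Lemma card_row2 t : #|row2 t| = l2.
Proof.
case: t => -[r1 r2] P; case/and3P: (P) => /= _ _ p.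
rewrite cardsE; have : uniq r2.
  by have := perm_uniq p; rewrite enum_uniq cat_uniq => /and3P[].
by move/card_uniqP => ->; rewrite size_tuple.
Qed.

Lemma sorted_enum_set (S : {set 'I_n}) : sorted (fun a b : 'I_n => a < b) (enum S).
Proof.
rewrite /enum_mem -enumT; apply: sorted_filter; first by move=> ? ? ?; exact: ltn_trans.
by have := iota_ltn_sorted 0 n; rewrite -val_enum_ord sorted_map.
Qed.

Lemma enum_row2 t : enum (row2 t) = (rows t).2.
Proof.
case: t => -[r1 r2] P; case/and3P: (P) => /= _ s2 p.
apply: (irr_sorted_eq (leT := fun a b : 'I_n => a < b)) => //.
- by move=> ? ? ?; exact: ltn_trans.
- by move=> ?; exact: ltnn.
- exact: sorted_enum_set.
- by move=> x; rewrite mem_enum inE.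
Qed.

Lemma enum_row1 t : enum (row1 t) = (rows t).1.
Proof.
case: t => -[r1 r2] P; case/and3P: (P) => /= s1 _ p.
apply: (irr_sorted_eq (leT := fun a b : 'I_n => a < b)) => //.
- by move=> ? ? ?; exact: ltn_trans.
- by move=> ?; exact: ltnn.
- exact: sorted_enum_set.
- by move=> x; rewrite mem_enum inE.
Qed.

(** Rows are increasing, hence determined by their sets of entries, and the first row is the
    complement of the second. *)
Lemma row2_inj : injective (@row2 n l1 l2).
Proof.
move=> s t E; apply: val_inj; rewrite /= [rows s]surjective_pairing [rows t]surjective_pairing.
by congr pair; apply: val_inj; rewrite /= -?enum_row1 -?enum_row2 ?row1E E.
Qed.

Lemma row2_exists (S : {set 'I_n}) : #|S| = l2 -> exists t, row2 t = S.
Proof.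
move=> S2.
have s2 : size (enum S) == l2 by rewrite -cardE S2.
have s1 : size (enum (~: S)) == l1 by rewrite -cardE cardsCs card_ord setCK S2 -l12n addnK.
have P : rsyt_pred (Tuple s1, Tuple s2).
  rewrite /rsyt_pred /= !sorted_enum_set /=; apply: uniq_perm.
  - rewrite cat_uniq !enum_uniq andbT /=; apply/hasPn => x.
    by rewrite /= !mem_enum inE => ->.
  - exact: enum_uniq.
  - by move=> x; rewrite mem_cat !mem_enum !inE orNb.
by exists (Rsyt P); apply/setP => x; rewrite inE /= mem_enum.
Qed.

Lemma cdesE t c : (c \in cdes t) = (c \notin row2 t) && (ordS c \in row2 t).
Proof. by rewrite inE row1E inE. Qed.

(** Re-sorting forgets the order, so rows may be compared as sets; the condition on the first row
    then follows by complementation. *)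
Lemma interchangedP a b s t :
  interchanged a b s t = (row2 t == tperm a b @: row2 s).
Proof.
have sortE (r r' : seq 'I_n) : sorted (fun x y : 'I_n => x < y) r' -> uniq r ->
  (sort (fun x y : 'I_n => x <= y) (map (tperm a b) r) == r') =
  ([set x in r'] == tperm a b @: [set x in r]).
  move=> sr' ur.
  have -> : tperm a b @: [set x in r] = [set x in map (tperm a b) r].
    apply/setP => x; rewrite inE; apply/imsetP/mapP => [] [y]; rewrite ?inE => yr ->;
    by exists y; rewrite ?inE.
  have le_tr : transitive (fun x y : 'I_n => x <= y) by move=> ? ? ?; exact: leq_trans.
  have le_as : antisymmetric (fun x y : 'I_n => x <= y).
    by move=> x y /anti_leq /val_inj.
  have le_tot : total (fun x y : 'I_n => x <= y) by move=> x y; exact: leq_total.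
  apply/eqP/eqP => [<-|/setP E]; first by apply/setP => x; rewrite !inE mem_sort.
  apply: (sorted_eq le_tr le_as); first exact: sort_sorted.
    by apply: sub_sorted sr' => x y; exact: ltnW.
  rewrite perm_sort; apply: uniq_perm.
  - by rewrite map_inj_uniq //; exact: perm_inj.
  - by apply: sorted_uniq sr' => [? ? ?|?]; [exact: ltn_trans|exact: ltnn].
  - by move=> x; have := E x; rewrite !inE.
have [t1 t2 _] := and3P (rowsP t); have [s1 s2 _] := and3P (rowsP s).
have uq (r : seq 'I_n) : sorted (fun x y : 'I_n => x < y) r -> uniq r.
  by apply: sorted_uniq => [? ? ?|?]; [exact: ltn_trans|exact: ltnn].
rewrite /interchanged !sortE ?uq // -/(row1 t) -/(row2 t) -/(row1 s) -/(row2 s).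
rewrite !row1E andbC; case: eqP => [Es|//] /=; apply/eqP/setP => x.
by rewrite mem_imset_tperm !in_setC Es mem_imset_tperm.
Qed.

End Tableaux.

(** * Relations between the weights of a W-graph *)

Lemma eq_from_subr (V : zmodType) (x y x' y' : V) :
  (x - y = x' - y' -> x' = y' -> x = y)%R.
Proof. by move=> E xy; apply/eqP; rewrite -GRing.subr_eq0 E xy GRing.subrr. Qed.

(** * Cancellation in the ring of Laurent polynomials, inherited from the fraction field *)

Section LaurentCancellation.
Local Open Scope ring_scope.

Lemma laurent_mulfI (c x y : laurent) : laurent_val c != 0 -> c * x = c * y -> x = y.
Proof.
move=> c0 /(congr1 laurent_val) E; apply/val_inj/(mulfI c0).
by have := E; rewrite -!(rmorphM (val : laurent -> _)).
Qed.

Lemma laurent_qhalf_neq0 : laurent_val qhalf != 0.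
Proof. by rewrite /= tofrac_eq0 polyX_eq0. Qed.

Lemma laurent_q_neq0 : laurent_val q != 0.
Proof.
rewrite /q -[laurent_val]/(val : laurent -> _) rmorphXn /= expf_neq0 //.
exact: laurent_qhalf_neq0.
Qed.

Lemma laurent_1q_neq0 : laurent_val (1 + q) != 0.
Proof.
rewrite /q -[laurent_val]/(val : laurent -> _) rmorphD rmorph1 rmorphXn /=.
rewrite -tofrac1 -tofracXn -tofracD tofrac_eq0.
apply/eqP => /(congr1 (fun p : {poly int} => p`_0)).
by rewrite coefD coefXn coef1 coef0 addr0.
Qed.

Lemma laurent_natr_inj (a b : nat) : (a%:R : laurent) = b%:R -> a = b.
Proof.
move=> /(congr1 (val : laurent -> _)); rewrite !rmorph_nat -!tofrac1 -!tofracMn.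
move=> /eqP; rewrite tofrac_eq => /eqP /(congr1 (fun p : {poly int} => p`_0)).
by rewrite -!polyC_natr !coefC /= => /eqP; rewrite Num.Theory.eqr_nat => /eqP.
Qed.

End LaurentCancellation.

(** * The Hecke relations rewritten for the operators [T i - q] *)

Section HeckeRelations.
Local Open Scope ring_scope.

Variables (R : comNzRingType) (V : lmodType R) (a : R).

(* The relations are tested on a coefficient functional [c], so that [ring] applies. *)
Section Functional.
Variables (f g : V -> V) (c : V -> R).
Hypothesis fB : forall x y, f (x - a *: y) = f x - a *: f y.
Hypothesis gB : forall x y, g (x - a *: y) = g x - a *: g y.
Hypothesis cD : forall x y, c (x + y) = c x + c y.
Hypothesis cB : forall x y, c (x - y) = c x - c y.
Hypothesis cZ : forall b x, c (b *: x) = b * c x.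

Lemma functional_quadratic x :
  f (f x + x) = f (f x) + f x -> f (f x + x) - a *: (f x + x) = 0 ->
  c (f (f x)) = (a - 1) * c (f x) + a * c x.
Proof.
have c0 : c 0 = 0 by rewrite -(subrr x) cB subrr.
move=> -> /(congr1 c); rewrite cB cZ !cD c0.
move: (c (f (f x))) (c (f x)) (c x) => u v w; by apply: eq_from_subr; ring.
Qed.

Lemma functional_comm x : f (g x) = g (f x) ->
  c (f (g x - a *: x) - a *: (g x - a *: x)) =
  c (g (f x - a *: x) - a *: (f x - a *: x)).
Proof. by rewrite fB gB !(cB, cZ) => ->; ring. Qed.

Hypothesis c_quad_f : forall x, c (f (f x)) = (a - 1) * c (f x) + a * c x.
Hypothesis c_quad_g : forall x, c (g (g x)) = (a - 1) * c (g x) + a * c x.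

(** Once the squares are eliminated by the quadratic relations, every term of the left side except
    [f (g (f x))] is symmetric in [f] and [g]. *)
Lemma functional_braid x : f (g (f x)) = g (f (g x)) ->
  let Ef y := f y - a *: y in let Eg y := g y - a *: y in
  c (Ef (Eg (Ef x)) - a *: Ef x) = c (Eg (Ef (Eg x)) - a *: Eg x).
Proof.
move=> E /=; rewrite !(fB, gB, cB, cZ) !c_quad_f !c_quad_g E.
by move: (c (f (g x))) (c (g (f x))) (c (f x)) (c (g x)) (c _) => ? ? ? ? ?; ring.
Qed.

End Functional.

End HeckeRelations.

Section HeckeCoefficients.
Local Open Scope ring_scope.

Variables (I : finType) (cox : I -> I -> nat) (K : choiceType).
Local Notation M := {malg laurent[K]}.
Variable T : I -> M -> M.
Hypothesis T_hecke : hecke_module cox T.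

(* Locked, as unification would otherwise unfold it in search of a difference. *)
Fact shifted_key : unit. Proof. by []. Qed.
Definition shifted i (x : M) : M :=
  locked_with shifted_key (fun y : M => T i y - q *: y) x.

Lemma shiftedE i x : shifted i x = T i x - q *: x.
Proof. by rewrite /shifted unlock. Qed.

Lemma hecke_opB i x y b : T i (x - b *: y) = T i x - b *: T i y.
Proof.
have [T_lin _ _] := T_hecke.
by rewrite [x - _]addrC -scaleNr T_lin scaleNr addrC.
Qed.

Lemma hecke_quadratic i k x :
  mcoeff k (T i (T i x)) = (q - 1) * mcoeff k (T i x) + q * mcoeff k x.
Proof.
have [T_lin T_quad _] := T_hecke.
apply: (@functional_quadratic _ _ q (T i) (mcoeff k)).
- exact: mcoeffD.
- exact: mcoeffB.
- by move=> b y; exact: mcoeffZ.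
- by have := T_lin i 1 (T i x) x; rewrite !scale1r.
- exact: T_quad.
Qed.

Lemma shifted_braid i j k x : i != j -> cox i j = 3%N ->
  mcoeff k (shifted i (shifted j (shifted i x))) - q * mcoeff k (shifted i x) =
  mcoeff k (shifted j (shifted i (shifted j x))) - q * mcoeff k (shifted j x).
Proof.
have [_ _ T_braid] := T_hecke; move=> ij cij.
have := T_braid i j x ij; rewrite cij /= => E.
rewrite -!mcoeffZ -!mcoeffB !shiftedE.
apply: (@functional_braid _ _ q (T i) (T j) (mcoeff k)) => //.
- by move=> ? ?; exact: hecke_opB.
- by move=> ? ?; exact: hecke_opB.
- exact: mcoeffB.
- by move=> b y; exact: mcoeffZ.
- by move=> ?; exact: hecke_quadratic.
- by move=> ?; exact: hecke_quadratic.
Qed.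

Lemma shifted_comm i j k x : i != j -> cox i j = 2%N ->
  mcoeff k (shifted i (shifted j x)) = mcoeff k (shifted j (shifted i x)).
Proof.
have [_ _ T_braid] := T_hecke; move=> ij cij.
have := T_braid i j x ij; rewrite cij /= => E.
rewrite !shiftedE.
apply: (@functional_comm _ _ q (T i) (T j) (mcoeff k)) => //.
- by move=> ? ?; exact: hecke_opB.
- by move=> ? ?; exact: hecke_opB.
- exact: mcoeffB.
- by move=> b y; exact: mcoeffZ.
Qed.

End HeckeCoefficients.

(** * Matrix coefficients of the W-graph operators, with vertices indexed by a finite type *)

Section WGraphCoefficients.
Local Open Scope ring_scope.

Variables (I T : finType) (cox : I -> I -> nat) (G : lgraph I).
Variables (g : T -> vertex G) (m : T -> T -> nat).
Hypothesis g_bij : bijective g.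
Hypothesis weightE : forall s t, weight (g s) (g t) = (m s t)%:R.
Hypothesis G_wgraph : is_wgraph cox G.

Local Notation tauT s := (tau (g s)).

Lemma sum_vertex (x : wgraph_module G) (F : vertex G -> laurent) :
  \sum_(u <- msupp x) mcoeff u x * F u = \sum_s mcoeff (g s) x * F (g s).
Proof.
have [f fK gK] := g_bij.
rewrite -[RHS](big_map g xpredT (fun u => mcoeff u x * F u)).
rewrite [RHS](bigID (fun u => u \in msupp x)) /= [RHS]addrC [X in _ = X + _]big1 ?add0r; last first.
  by move=> u /mcoeff_outdom ->; rewrite mul0r.
rewrite -[RHS]big_filter; apply: perm_big; apply: uniq_perm.
- exact: fset_uniq.
- by rewrite filter_uniq // map_inj_uniq ?index_enum_uniq //; exact: can_inj fK.
move=> u; rewrite mem_filter.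
by rewrite -[u in RHS]gK mem_map ?mem_index_enum ?andbT ?gK //; exact: can_inj fK.
Qed.

Lemma wgraph_op_coef i x t :
  mcoeff (g t) (wgraph_op i x) =
  \sum_s mcoeff (g s) x * mcoeff (g t) (wgraph_gen i (g s)).
Proof.
rewrite /wgraph_op raddf_sum /=.
rewrite -(sum_vertex x (fun u => mcoeff (g t) (wgraph_gen i u))).
by apply: eq_bigr => u _; rewrite mcoeffZ.
Qed.

Lemma wgraph_basis_coef (u v : vertex G) :
  mcoeff v (wgraph_basis u) = (u == v)%:R.
Proof. by rewrite /wgraph_basis mcoeffU. Qed.

Lemma g_eq s t : (g s == g t) = (s == t).
Proof. by rewrite (inj_eq (bij_inj g_bij)). Qed.

(* The matrix entries of [T_i - q]. *)
Definition opcoef i s t : laurent :=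
  if i \in tauT s then
    if i \in tauT t then - (1 + q) * (s == t)%:R else qhalf * (m s t)%:R
  else 0.

Lemma wgraph_gen_coef i s t :
  mcoeff (g t) (wgraph_gen i (g s)) = q * (s == t)%:R + opcoef i s t.
Proof.
rewrite /wgraph_gen /opcoef; case: ifPn => si; last first.
  by rewrite mcoeffZ wgraph_basis_coef g_eq addr0.
rewrite mcoeffD mcoeffN mcoeffZ wgraph_basis_coef g_eq.
have -> : mcoeff (g t) (\sum_(v \in [set v | i \notin tau v]%classic)
    weight (g s) v *: wgraph_basis v) = if i \in tauT t then 0 else (m s t)%:R.
  have [f fK gK] := g_bij.
  have g_inj := can_inj fK.
  (* Since [g] is onto, the image of [T] lists all vertices, so the finitely supported sum becomes a
     sum over a list. *)
  rewrite (fsbigE [seq v <- [seq g a | a : T] | i \notin tau v]); first last.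
  - move=> v /= vi; rewrite mem_filter vi /= => /negP[].
    by rewrite -[v]gK; apply: map_f; rewrite mem_enum.
  - by move=> v /=; rewrite mem_filter => /andP[].
  - by rewrite filter_uniq // map_inj_uniq ?enum_uniq.
  rewrite big_filter_cond big_map raddf_sum /= big_enum_cond /=.
  under eq_bigr do rewrite mcoeffZ wgraph_basis_coef g_eq weightE.
  case: ifPn => ti.
    apply: big1 => a /andP[ai _]; case: eqP => [at_|_]; last by rewrite mulr0.
    by rewrite at_ ti in ai.
  rewrite (bigD1 t) /=; last by rewrite mem_set /= ?ti.
  rewrite eqxx mulr1 big1 ?addr0 // => a /andP[_ /negPf ->].
  by rewrite mulr0.
case: ifPn => ti; first by ring.
have -> : (s == t) = false by apply: contraNF ti => /eqP <-.
by rewrite !mulr0 oppr0 !add0r.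
Qed.


Local Notation E := (shifted (@wgraph_op I G)).

Lemma shifted_op_coef i x t :
  mcoeff (g t) (E i x) = \sum_s mcoeff (g s) x * opcoef i s t.
Proof.
rewrite shiftedE mcoeffB mcoeffZ wgraph_op_coef.
under eq_bigr do rewrite wgraph_gen_coef mulrDr.
rewrite big_split /= [X in X + _ - _](bigD1 t) //= eqxx big1 => [|s /negPf ->].
  by rewrite addr0 mulr1; ring.
by rewrite mulr0 mulr0.
Qed.

Lemma shifted_op_basis i s t :
  mcoeff (g t) (E i (wgraph_basis (g s))) = opcoef i s t.
Proof.
rewrite shifted_op_coef (bigD1 s) //= wgraph_basis_coef eqxx mul1r.
by rewrite big1 ?addr0 // => a /negPf sa; rewrite wgraph_basis_coef g_eq eq_sym sa mul0r.
Qed.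


Lemma shifted_basis2 i j s t :
  mcoeff (g t) (E j (E i (wgraph_basis (g s)))) =
  \sum_a opcoef i s a * opcoef j a t.
Proof.
by rewrite shifted_op_coef; apply: eq_bigr => a _; rewrite shifted_op_basis.
Qed.

Lemma shifted_basis3 i j k s t :
  mcoeff (g t) (E k (E j (E i (wgraph_basis (g s))))) =
  \sum_b (\sum_a opcoef i s a * opcoef j a b) * opcoef k b t.
Proof.
by rewrite shifted_op_coef; apply: eq_bigr => a _; rewrite shifted_basis2.
Qed.

Lemma opcoef_braid i j s t : i != j -> cox i j = 3%N ->
  \sum_b (\sum_a opcoef i s a * opcoef j a b) * opcoef i b t - q * opcoef i s t =
  \sum_b (\sum_a opcoef j s a * opcoef i a b) * opcoef j b t - q * opcoef j s t.
Proof.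
move=> ij cij; pose F (u v : laurent) := u - q * v.
have H k l := f_equal2 F (shifted_basis3 k l k s t) (shifted_op_basis k s t).
by apply: etrans (esym (H i j)) (etrans _ (H j i)); apply: (shifted_braid G_wgraph).
Qed.

Lemma opcoef_comm i j s t : i != j -> cox i j = 2%N ->
  \sum_a opcoef i s a * opcoef j a t = \sum_a opcoef j s a * opcoef i a t.
Proof.
move=> ij cij; apply: etrans (esym (shifted_basis2 i j s t)) _.
apply: etrans (shifted_basis2 j i s t); apply/esym; exact: (shifted_comm G_wgraph).
Qed.

Hypothesis tau_adj : forall i j s, cox i j = 3%N -> ~~ ((i \in tauT s) && (j \in tauT s)).

(** With [E i = T i - q], compare the coefficients of [t] in [E i E j E i - q E i] and
    [E j E i E j - q E j] applied to [s]. The first is [0] because [i] is not in [tau] of [s]; the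
    second is [-(1 + q) q] times the difference of the two sides of the claim. *)
Lemma wgraph_bond i j s t : i != j -> cox i j = 3%N ->
  j \in tauT s -> j \in tauT t ->
  (\sum_(a | i \in tauT a) m s a * m a t)%N = (s == t).
Proof.
move=> ij cij js jt.
have notj a : i \in tauT a -> j \in tauT a = false.
  by move=> ia; have := tau_adj a cij; rewrite ia; case: (j \in _).
have noti a : j \in tauT a -> i \in tauT a = false.
  by move=> ja; have := tau_adj a cij; rewrite ja andbT => /negPf.
have := opcoef_braid s t ij cij.
rewrite [X in X - _]big1 => [|b _]; last first.
  rewrite big1 ?mul0r // => a _; rewrite /opcoef (noti s) ?mul0r //.
have -> : opcoef i s t = 0 by rewrite /opcoef noti.
(* As [j] lies in [tau] of [t], the last factor [opcoef j b t] vanishes unless [b = t]. *)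
rewrite (bigD1 t) //= [X in _ = _ + X - _]big1 => [|b bt]; last first.
  by rewrite /opcoef; case: ifP => jb; rewrite ?mulr0 // jt (negPf bt) mulr0 mulr0.
rewrite /opcoef js jt eqxx.
rewrite (bigID (fun a => i \in tauT a)) /=.
rewrite [X in _ = (_ + X) * _ + _ - _]big1 => [|a /negPf ->]; last first.
  by rewrite mulr0.
rewrite (eq_bigr (fun a => q * (m s a * m a t)%N%:R)) => [|a ia]; last first.
  rewrite ia notj // (noti t) // natrM /q expr2.
  by move: (m s a)%:R (m a t)%:R => ? ?; ring.
rewrite -mulr_sumr -natr_sum; move: (\sum_(a | _) _)%N => N E0.
apply: laurent_natr_inj.
apply: (laurent_mulfI laurent_q_neq0); apply: (laurent_mulfI laurent_1q_neq0).
by move: E0; move: (N%:R) ((_ == _)%:R) => x y; apply: eq_from_subr; rewrite mulr1n; ring.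
Qed.

(** [E j] kills [s], so [E i] after [E j] contributes [0]; in the other order only the intermediate
    vertex [t] survives and contributes [m s t] times a nonzero scalar. *)
Lemma wgraph_compatibility i j s t : i != j -> cox i j = 2%N ->
  i \in tauT s -> j \notin tauT s -> i \notin tauT t -> j \in tauT t -> m s t = 0%N.
Proof.
move=> ij cij si sj ti tj.
have := opcoef_comm s t ij cij.
rewrite [RHS]big1 => [|a _]; last by rewrite /opcoef (negPf sj) mul0r.
rewrite (bigD1 t) //= big1 => [|a at_]; last first.
  by rewrite [opcoef j _ _]/opcoef tj (negPf at_) mulr0; case: ifP; rewrite mulr0.
rewrite /opcoef si (negPf ti) tj eqxx addr0 => E0.
apply: laurent_natr_inj.
apply: (laurent_mulfI laurent_qhalf_neq0); apply: (laurent_mulfI laurent_1q_neq0).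
apply: oppr_inj; move: E0; move: (m s t)%:R => x.
by apply: eq_from_subr; rewrite mulr1n mulr0n; ring.
Qed.

(** Both sums occur in the coefficient of [t] in the two products of [E i] and [E j] applied to [s].
    The intermediate vertex [s] gives a term symmetric in [i] and [j], which cancels. *)
Lemma wgraph_polygon i j s t : i != j -> cox i j = 2%N -> cox j i = 2%N ->
  i \in tauT s -> j \in tauT s -> i \notin tauT t -> j \notin tauT t ->
  (\sum_(a | (i \in tauT a) && (j \notin tauT a)) m s a * m a t =
   \sum_(a | (j \in tauT a) && (i \notin tauT a)) m s a * m a t)%N.
Proof.
suff half i' j' : i' \in tauT s -> j' \in tauT s -> i' \notin tauT t -> j' \notin tauT t ->
    \sum_a opcoef i' s a * opcoef j' a t = - (1 + q) * qhalf * (m s t)%:R +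
      q * (\sum_(a | (j' \in tauT a) && (i' \notin tauT a)) m s a * m a t)%N%:R.
  move=> ij cij cji si sj ti tj.
  have := opcoef_comm s t ij cij.
  rewrite !half // => /addrI E0.
  by apply/laurent_natr_inj/(laurent_mulfI laurent_q_neq0).
move=> si sj ti tj.
rewrite (bigD1 s) //= {1 2}/opcoef si sj (negPf tj) eqxx mulr1n mulr1 -mulrA; congr (_ + _).
rewrite (bigID (fun a => (j' \in tauT a) && (i' \notin tauT a))) /=.
rewrite [X in _ + X]big1 ?addr0 => [|a /andP[as_]]; last first.
  rewrite /opcoef si eq_sym (negPf as_); case: ifP; case: ifP => //= _ _; rewrite ?mulr0 ?mul0r //.
rewrite natr_sum mulr_sumr.
apply: eq_big => a.
  by case: eqP => [->|_] //=; rewrite si andbF.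
move=> /andP[_ /andP[ja /negPf ia]].
rewrite /opcoef si ia ja (negPf tj) natrM /q expr2.
by move: (m s a)%:R (m a t)%:R => ? ?; ring.
Qed.

End WGraphCoefficients.

(** * The dual action on words *)

Section TableauWords.
Variables n l1 l2 : nat.
Hypothesis n_gt2 : 2 < n.
Hypothesis l12n : l1 + l2 = n.
Local Notation rsyt := (rsyt n l1 l2).
Local Notation wd t c := (word (row2 t) c).
Implicit Types (s t u : rsyt) (c : 'I_n) (w : seq bool).

Lemma wd_inj c s t : wd s c = wd t c -> s = t.
Proof. by move=> /word_inj /row2_inj. Qed.

Lemma wd_eq c s t : (wd s c == wd t c) = (s == t).
Proof. by apply/eqP/eqP => [/wd_inj|->]. Qed.

Lemma wd_exists c w : size w = n -> count id w = l2 -> exists t, wd t c = w.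
Proof.
move=> wn w2; have [S SE] := word_exists c wn.
have [|t tE] := row2_exists l12n (S := S); first by rewrite -(count_word S c) SE.
by exists t; rewrite tE.
Qed.

Lemma count_wd t c : count id (wd t c) = l2.
Proof. by rewrite count_word card_row2. Qed.

Definition peak w k := ~~ nth false w k && nth false w k.+1.

Lemma cdes_peak t c k : k.+1 < n -> (iter k (@ordS n) c \in cdes t) = peak (wd t c) k.
Proof. by move=> kn; rewrite cdesE /peak !nth_word //; exact: ltnW. Qed.

Lemma interchanged_word s t c a B b C : wd s c = a :: B ++ b :: C ->
  interchanged c (iter (size B).+1 (@ordS n) c) s t = (wd t c == b :: B ++ a :: C).
Proof.
move=> sE; rewrite interchangedP -(word_tperm sE).
by apply/eqP/eqP => [->//|/word_inj].
Qed.

(** A swap of cyclic neighbours that changes the letter at position [1] must involve that position,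
    hence also position [0] or [2]. *)
Lemma swap_middle c i s t y0 y1 y2 r : interchanged i (ordS i) s t ->
  wd s c = [:: y0, y1, y2 & r] -> nth false (wd t c) 1 != y1 ->
  wd t c = [:: y1, y0, y2 & r] \/ wd t c = [:: y0, y2, y1 & r].
Proof.
move=> sw sE; rewrite nth_word ?(ltnW n_gt2) // => t1.
have [p pn iE] := iter_ordS_surj c i.
case: p => [|[|p]] in pn iE.
- left; move: sw; rewrite iE /=.
  by rewrite (interchanged_word (B := [::]) t sE) => /eqP.
(* The word is read from [ordS c], so that the swap occurs at its start, and is rotated back by
   [n - 1] letters afterwards. *)
- right; have sE' := word_shift (u := [:: y0]) sE.
  move: sw; rewrite iE.
  rewrite (interchanged_word (B := [::]) t sE') /= => /eqP tE.
  have := @word_shift _ _ _ [:: y2, y1 & r] [:: y0] tE.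
  rewrite -iterSr; have -> : (size [:: y2, y1 & r]).+1 = n.
    by have := size_word (row2 s) c; rewrite sE /=; lia.
  by rewrite iter_ordS_n.
(* Any other swap fixes position [1], even when it wraps around and exchanges the last letter with
   the first. *)
case/eqP: t1; have <- : (ordS c \in row2 s) = y1.
  by have := nth_word (row2 s) c (ltnW n_gt2); rewrite sE.
move: sw; rewrite interchangedP => /eqP ->.
rewrite mem_imset_tperm tpermD //.
  by rewrite iE; apply/eqP => /(@iter_ordS_inj _ c p.+2 1); lia.
rewrite iE -iterS; have [p3|p3] := ltnP p.+3 n.
  by apply/eqP => /(@iter_ordS_inj _ c p.+3 1); lia.
have -> : p.+3 = n by lia.
by rewrite iter_ordS_n; apply/eqP => /(@iter_ordS_inj _ c 0 1); lia.
Qed.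

Definition adjacent (i j : 'I_n) := (j == ordS i) || (i == ordS j).

Section Weights.
Variable m : rsyt -> rsyt -> nat.
Hypothesis bond : forall i j s t, i != j -> adjacent i j ->
  j \in cdes s -> j \in cdes t -> \sum_(a | i \in cdes a) m s a * m a t = (s == t).
Hypothesis compatibility : forall i j s t, i != j -> ~~ adjacent i j ->
  i \in cdes s -> j \notin cdes s -> i \notin cdes t -> j \in cdes t -> m s t = 0.
Hypothesis polygon : forall i j s t, i != j -> ~~ adjacent i j ->
  i \in cdes s -> j \in cdes s -> i \notin cdes t -> j \notin cdes t ->
  \sum_(a | (i \in cdes a) && (j \notin cdes a)) m s a * m a t =
  \sum_(a | (j \in cdes a) && (i \notin cdes a)) m s a * m a t.
Hypothesis simple_edge : forall s t, m s t = 1 -> m t s = 1 ->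
  exists i, interchanged i (ordS i) s t.

(* [a0] is the only term of [bond] for [s = t].  Any other [a] with [m a t != 0] would
   have [m b a = 0] for all [b] with [j \in cdes b], contradicting [bond] at [a]. *)
Lemma bond_unique i j t : i != j -> adjacent i j -> j \in cdes t ->
  exists a0, [/\ i \in cdes a0, m t a0 = 1, m a0 t = 1 &
    forall a, i \in cdes a -> m a t = (a == a0)].
Proof.
move=> ij adj_ij jt.
have ji : j != i by rewrite eq_sym.
have adj_ji : adjacent j i by rewrite /adjacent orbC.
have /eqP := bond ij adj_ij jt jt; rewrite eqxx => S1.
have [a0 ia0 m0] : exists2 a0, i \in cdes a0 & m t a0 * m a0 t != 0.
  have : (\sum_(a | i \in cdes a) m t a * m a t) != 0 by rewrite (eqP S1).
  by rewrite sum_nat_eq0 negb_forall => /existsP[a]; rewrite negb_imply => /andP[]; exists a.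
move: S1; rewrite (bigD1 a0) //= => S1.
have := m0; rewrite muln_eq0 negb_or -!lt0n => /andP[ta0 a0t].
have [mta0 ma0t] : m t a0 = 1 /\ m a0 t = 1.
  have : m t a0 * m a0 t == 1 by move: S1; move: m0; lia.
  by rewrite muln_eq1 => /andP[/eqP -> /eqP ->].
exists a0; split=> // a ia; case: eqP => [->//|/eqP aa0] /=.
have ta_0 : m t a * m a t = 0.
  move: S1; rewrite mta0 ma0t mul1n (bigD1 a) /= ?ia //; lia.
apply/eqP; apply/negPn/negP => ma.
have /eqP := bond ji adj_ji ia ia; rewrite eqxx; apply/negP.
rewrite big1 // => b jb; have [bt|bt] := eqVneq b t.
  by rewrite bt mulnC.
have := bond ij adj_ij jb jt; rewrite (negPf bt) => /eqP.
rewrite sum_nat_eq0 => /forallP /(_ a); rewrite ia muln_eq0 (negPf ma) orbF => /eqP ->.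
by rewrite muln0.
Qed.

(* In the dual module, [F_i] at the [k]-th letter of [w] sends the tableau with word [w]
   to the one with word [w'] if [o = Some w'], and to [0] if [o = None]. *)
Record acts_at k w (o : option (seq bool)) : Prop := ActsAt {
  acts_atP : forall c t u, wd t c = w ->
    iter k (@ordS n) c \in cdes u -> m u t = (Some (wd u c) == o) }.

Lemma acts_at_shift p q p' q' : size p = size p' ->
  acts_at 0 (q ++ p) (Some (q' ++ p')) -> acts_at (size p) (p ++ q) (Some (p' ++ q')).
Proof.
move=> pp' A; split=> c t u tE cu; rewrite (acts_atP A (word_shift tE) cu); congr nat_of_bool.
apply/eqP/eqP => -[] E; congr Some; last by rewrite pp'; exact: word_shift.
apply: (can_inj (rotK (size p))); rewrite {2}pp' rot_size_cat -word_rot //.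
have := size_word (row2 t) c; rewrite tE size_cat; lia.
Qed.

(** By [bond_unique] the image is a single tableau, joined to [t] by a neighbour swap. It must have
    a cup at the first two letters, and [swap_middle] leaves only this word. *)
Lemma acts_cup_left x r : acts_at 0 [:: x, false, true & r] (Some [:: false, true, x & r]).
Proof.
split=> c t u tE /= cu.
have n1 := ltnW n_gt2.
have jt : ordS c \in cdes t by rewrite (@cdes_peak t c 1) // tE.
have cc : c != ordS c by apply/eqP => /(@iter_ordS_inj _ c 0 1); lia.
have [|a0 [ca0 m1 m2 ->//]] := bond_unique cc _ jt; first by rewrite /adjacent eqxx.
rewrite -(wd_eq c); congr nat_of_bool; congr (_ == _).
have [i sw] := simple_edge m1 m2.
move: ca0; rewrite (@cdes_peak a0 c 0) // /peak => /andP[a00 a01].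
have [|E|E] := swap_middle sw tE; first by rewrite a01.
  by move: a00 a01; rewrite E /=; case: x {tE E}.
by move: a00 a01; rewrite E /=; case: x {tE E}.
Qed.

(** Here the cup consists of the last and the first letter, so the word is read from the predecessor
    [d] of [c], where the argument for [acts_cup_left] applies. *)
Lemma acts_cup_right x r :
  acts_at 0 (true :: x :: r ++ [:: false]) (Some (false :: true :: r ++ [:: x])).
Proof.
split=> c t u tE /= cu.
have n1 := ltnW n_gt2.
have [d tdE dc] : exists2 d, wd t d = [:: false, true, x & r] & ordS d = c.
  exists (iter (size (true :: x :: r)) (@ordS n) c).
    exact: (@word_shift _ _ _ (true :: x :: r) [:: false] tE).
  rewrite -iterS; have -> : (size (true :: x :: r)).+1 = n.
    by have := size_word (row2 t) c; rewrite tE /= size_cat /=; lia.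
  exact: iter_ordS_n.
have dt : d \in cdes t by rewrite (@cdes_peak t d 0) // tdE.
have cd : c != d by rewrite -dc; apply/eqP => /(@iter_ordS_inj _ d 1 0); lia.
have [|a0 [ca0 m1 m2 ->//]] := bond_unique cd _ dt; first by rewrite /adjacent dc eqxx orbT.
have [i sw] := simple_edge m1 m2.
suff <- : wd a0 c = false :: true :: r ++ [:: x] by rewrite -(wd_eq c).
move: ca0; rewrite -dc (@cdes_peak a0 d 1) // /peak => /andP[a00 a01].
suff E : wd a0 d = [:: x, false, true & r] by have := @word_shift _ _ _ [:: x] _ E.
have [|E|E] := swap_middle sw tdE; first by case: nth a00.
  by move: a00 a01; rewrite E /=; case: x {tE tdE E}.
by move: a00 a01; rewrite E /=; case: x {tE tdE E}.
Qed.

(** * Commuting a distant dual operator past the one at the first letter *)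

Section Slide.
Variables (k : nat) (w w' : seq bool).
Hypotheses (k_gt1 : 1 < k) (kn : k.+1 < n).
Hypotheses (w_size : size w = n) (w_count : count id w = l2).
Hypotheses (ww' : acts_at k w (Some w')) (wk : ~~ peak w k) (w'k : peak w' k).
Hypotheses (w0 : ~~ peak w 0) (w'0 : ~~ peak w' 0).

(* [F_i w' = F_i (F_j w) = F_j (F_i w)]. *)
Lemma slide_sum c t t' u : wd t c = w -> wd t' c = w' -> c \in cdes u ->
  let j := iter k (@ordS n) c in
  m u t' = (if j \in cdes u then
    \sum_(a | (c \in cdes a) && (j \notin cdes a)) m u a * m a t else 0).
Proof.
move=> tE t'E cu j.
have n1 := ltnW n_gt2.
have c0 v : (c \in cdes v) = peak (wd v c) 0 := cdes_peak v c n1.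
have jk v : (j \in cdes v) = peak (wd v c) k := cdes_peak v c kn.
have cj : c != j by apply/eqP => /(@iter_ordS_inj _ c 0 k); lia.
have ncj : ~~ adjacent c j.
  apply/norP; split; apply/eqP; last by move=> /(@iter_ordS_inj _ c 0 k.+1); lia.
  by move=> /(@iter_ordS_inj _ c k 1); lia.
case: ifPn => ju; last first.
  by apply: (compatibility cj ncj) => //; rewrite ?c0 ?jk t'E.
rewrite (polygon cj ncj) // ?c0 ?jk ?tE //.
have jt' : j \in cdes t' by rewrite jk t'E.
have mt a : j \in cdes a -> m a t = (a == t').
  by move=> /(acts_atP ww' tE) ->; rewrite -t'E -(wd_eq c).
rewrite (bigD1 t') /= ?jt' ?c0 ?t'E //= mt // eqxx muln1 big1 ?addn0 // => a.
by case/andP=> /andP[ja _] /negPf at'; rewrite mt // at' muln0.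
Qed.

Lemma slide_none : acts_at 0 w None -> acts_at 0 w' None.
Proof.
move=> A; split=> c t' u t'E cu; have [t tE] := wd_exists c w_size w_count.
rewrite (slide_sum tE t'E cu); case: ifP => // _.
by apply: big1 => a /andP[ca _]; rewrite (acts_atP A tE ca) muln0.
Qed.

Variables v v' : seq bool.
Hypotheses (v_count : count id v = count id v') (v_size : size v = size v').
Hypotheses (vv' : acts_at k v (Some v')) (vk : ~~ peak v k) (v'k : peak v' k).
Hypothesis v0 : peak v 0.

(** With [F_i] at the first letter and [F_j] at the [k]-th, [F_i w' = F_i (F_j w) = F_j (F_i w) =
    F_j v = v']. *)
Lemma slide_some : acts_at 0 w (Some v) -> acts_at 0 w' (Some v').
Proof.
have someE (a b : seq bool) : (Some a == Some b) = (a == b).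
  by apply/eqP/eqP => [[]|->].
move=> A; split=> c t' u t'E cu; have [t tE] := wd_exists c w_size w_count.
have n1 := ltnW n_gt2.
rewrite (slide_sum tE t'E cu) cdes_peak //; case: ifPn => uk; last first.
  by case: eqP => // -[uv']; rewrite uv' v'k in uk.
have jk a : (iter k (@ordS n) c \in cdes a) = peak (wd a c) k := cdes_peak a c kn.
rewrite (eq_bigr (fun a => (wd u c == v') * (wd a c == v))) => [|a /andP[ca _]]; last first.
  rewrite (acts_atP A tE ca) !someE; case: eqP => [av|_]; last by rewrite !muln0.
  by rewrite !muln1 (acts_atP vv' av) ?jk // someE.
rewrite -big_distrr /=; case: eqP => [uv'|uv']; last first.
  by rewrite mul0n; case: eqP => // -[].
rewrite mul1n uv' eqxx.
(* The word [v] has the length and letter count of [v'], the word of [u], so it belongs to a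
   tableau; that tableau gives the only nonzero term. *)
have [||b bE] := @wd_exists c v.
- by rewrite v_size -uv' size_word.
- by rewrite v_count -uv' count_wd.
rewrite (bigD1 b) /= ?bE ?eqxx /=; last first.
  by rewrite jk bE vk andbT (@cdes_peak b c 0) ?bE.
by rewrite big1 // => a /andP[_ /negPf ab]; rewrite -bE wd_eq ab.
Qed.

End Slide.


Lemma acts_at_wf k w o :
  (size w = n -> count id w = l2 -> acts_at k w o) -> acts_at k w o.
Proof.
move=> A; split=> c t u tE; apply: acts_atP (tE); apply: A; by rewrite -tE ?size_word ?count_wd.
Qed.

Lemma peak_cat p q k j : j = size p + k -> peak (p ++ q) j = peak q k.
Proof.
by move=> ->; rewrite /peak -addnS !nth_cat !addKn !ltnNge !leq_addr.
Qed.

Lemma acts_cup_left_at x y p z r :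
  acts_at (size p).+2 (x :: y :: p ++ [:: z, false, true & r])
    (Some (x :: y :: p ++ [:: false, true, z & r])).
Proof.
apply: (@acts_at_shift (x :: y :: p) _ (x :: y :: p)) => //.
exact: acts_cup_left.
Qed.

Lemma acts_cup_right_at x y p z r :
  acts_at (size p).+3 (x :: y :: p ++ [:: false, true, z & r])
    (Some (x :: y :: p ++ [:: z, false, true & r])).
Proof.
have := @acts_at_shift (x :: y :: rcons p false) (true :: z :: r)
  (x :: y :: rcons p z) [:: false, true & r].
rewrite /= !size_rcons -!cats1 -!catA /= => /(_ erefl); apply.
have := @acts_cup_right z (r ++ x :: y :: p).
by rewrite -!catA.
Qed.

(** * Sliding a cup along a word whose first two letters do not form a cup *)

Section SlideCup.
Variables (x y : bool).
Hypothesis xy : x || ~~ y.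

Lemma peak_xy r : ~~ peak (x :: y :: r) 0.
Proof. by rewrite /peak /=; move: xy; case: (x); case: (y). Qed.

(** The operator at the closing letter of the cup moves the cup one place to the right, so
    [slide_none] applies with this operator as [F_j]. *)
Lemma slide_right1_none p z r :
  acts_at 0 (x :: y :: p ++ [:: false, true, z & r]) None ->
  acts_at 0 (x :: y :: p ++ [:: z, false, true & r]) None.
Proof.
move=> A; apply: acts_at_wf => ws wc.
apply: (@slide_none (size p).+3 _ _ _ _ _ _ (@acts_cup_right_at x y p z r)) => //;
  rewrite ?peak_xy //.
- by move: ws; rewrite /= size_cat /=; lia.
- by rewrite -ws /= !size_cat.
- by rewrite -wc /= !count_cat /=; lia.
- by rewrite (@peak_cat (x :: y :: p) _ 1) //= addn1.
- by rewrite (@peak_cat (x :: y :: p) _ 1) //= addn1.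
Qed.

(** The cup occupies the same place in the word and in its image, so one and the same distant
    operator moves it in both. *)
Lemma slide_right1 p z r p' z' r' : size p' = size p -> size r' = size r ->
  acts_at 0 (x :: y :: p ++ [:: false, true, z & r])
    (Some [:: false, true & p' ++ [:: false, true, z' & r']]) ->
  acts_at 0 (x :: y :: p ++ [:: z, false, true & r])
    (Some [:: false, true & p' ++ [:: z', false, true & r']]).
Proof.
move=> pp' rr' A; apply: acts_at_wf => ws wc.
apply: (slide_some _ _ _ _ (@acts_cup_right_at x y p z r) _ _ _ _ _ _
  (v := [:: false, true & p' ++ [:: false, true, z' & r']])) => //;
  rewrite ?peak_xy //.
- by move: ws; rewrite /= size_cat /=; lia.
- by rewrite -ws /= !size_cat.
- by rewrite -wc /= !count_cat /=; lia.
- by rewrite (@peak_cat (x :: y :: p) _ 1) //= addn1.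
- by rewrite (@peak_cat (x :: y :: p) _ 1) //= addn1.
- by rewrite /= !count_cat /=; lia.
- by rewrite /= !size_cat.
- by rewrite -pp'; exact: acts_cup_right_at.
- by rewrite (@peak_cat [:: false, true & p'] _ 1) //= addn1 -pp'.
- by rewrite (@peak_cat [:: false, true & p'] _ 1) //= addn1 -pp'.
Qed.

Lemma slide_left1 p z r p' z' r' : size p' = size p -> size r' = size r ->
  acts_at 0 (x :: y :: p ++ [:: z, false, true & r])
    (Some [:: false, true & p' ++ [:: z', false, true & r']]) ->
  acts_at 0 (x :: y :: p ++ [:: false, true, z & r])
    (Some [:: false, true & p' ++ [:: false, true, z' & r']]).
Proof.
move=> pp' rr' A; apply: acts_at_wf => ws wc.
apply: (slide_some _ _ _ _ (@acts_cup_left_at x y p z r) _ _ _ _ _ _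
  (v := [:: false, true & p' ++ [:: z', false, true & r']])) => //;
  rewrite ?peak_xy //.
- by move: ws; rewrite /= size_cat /=; lia.
- by rewrite -ws /= !size_cat.
- by rewrite -wc /= !count_cat /=; lia.
- by rewrite (@peak_cat (x :: y :: p) _ 0) //= ?addn0 // /peak /= andbF.
- by rewrite (@peak_cat (x :: y :: p) _ 0) //= addn0.
- by rewrite /= !count_cat /=; lia.
- by rewrite /= !size_cat.
- by rewrite -pp'; exact: acts_cup_left_at.
- by rewrite (@peak_cat [:: false, true & p'] _ 0) //= ?addn0 -?pp' // /peak /= andbF.
- by rewrite (@peak_cat [:: false, true & p'] _ 0) //= addn0 -pp'.
Qed.

Lemma slide_right_none p q r :
  acts_at 0 (x :: y :: p ++ [:: false, true & q ++ r]) None ->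
  acts_at 0 (x :: y :: p ++ q ++ [:: false, true & r]) None.
Proof.
elim: q p => [//|z q IH] p /slide_right1_none A /=.
by rewrite -cat_rcons; apply: IH; rewrite cat_rcons.
Qed.

Lemma slide_right p q r p' q' r' :
  size p' = size p -> size q' = size q -> size r' = size r ->
  acts_at 0 (x :: y :: p ++ [:: false, true & q ++ r])
    (Some [:: false, true & p' ++ [:: false, true & q' ++ r']]) ->
  acts_at 0 (x :: y :: p ++ q ++ [:: false, true & r])
    (Some [:: false, true & p' ++ q' ++ [:: false, true & r']]).
Proof.
move=> + + rr'; elim: q q' p p' => [|z q IH] [|z' q'] p p' //= pp' [qq'].
move=> /slide_right1 A; rewrite -(cat_rcons z p) -(cat_rcons z' p').
by apply: IH => //; rewrite ?size_rcons ?pp' // !cat_rcons; apply: A; rewrite // !size_cat rr' qq'.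
Qed.

Lemma slide_left p q r p' q' r' :
  size p' = size p -> size q' = size q -> size r' = size r ->
  acts_at 0 (x :: y :: p ++ q ++ [:: false, true & r])
    (Some [:: false, true & p' ++ q' ++ [:: false, true & r']]) ->
  acts_at 0 (x :: y :: p ++ [:: false, true & q ++ r])
    (Some [:: false, true & p' ++ [:: false, true & q' ++ r']]).
Proof.
move=> + + rr'; elim: q q' p p' => [|z q IH] [|z' q'] p p' //= pp' [qq'] A.
apply: slide_left1; rewrite // ?size_cat ?rr' ?qq' //.
rewrite -(cat_rcons z p) -(cat_rcons z' p').
by apply: IH => //; rewrite ?size_rcons ?pp' // !cat_rcons.
Qed.

End SlideCup.

(** Read cyclically, the [false] before [D] is the partner of the first letter. Each cup inside [D]
    is slid out into [S]; when none is left the partners are adjacent, which is [acts_cup_right]. *)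
Lemma acts_match_left D S y : dyck D ->
  acts_at 0 [:: true, y & S ++ false :: D] (Some [:: false, true & S ++ y :: D]).
Proof.
move=> dD; elim: dD S => [|p q _ IH] S; first exact: acts_cup_right.
have := IH (S ++ [:: false; true]).
rewrite -!catA /= => /(@slide_right true y isT S (false :: p) q S (y :: p) q).
by apply.
Qed.

(** The mirror situation: the second letter has its partner just after [D], and the cups inside [D]
    are slid to the right beyond that partner until [acts_cup_left] applies. *)
Lemma acts_match_right D S x : dyck D ->
  acts_at 0 [:: x, false & D ++ true :: S] (Some [:: false, true & D ++ x :: S]).
Proof.
move=> dD; elim: dD S => [|p q _ IH] S; first exact: acts_cup_left.
have xf : x || ~~ false by rewrite orbT.
have := IH [:: false, true & S]; rewrite -!catA /= -!(cat1s _ (_ :: _ :: S)) !(catA q).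
move=> /(@slide_left x false xf p (q ++ [:: true]) S p (q ++ [:: x]) S).
by rewrite -!catA; apply; rewrite // !size_cat.
Qed.

Definition cups k := iter k (fun w => [:: false, true & w]) [::].

Lemma cupsSr k w : cups k.+1 ++ w = cups k ++ [:: false, true & w].
Proof. by elim: k => //= k ->. Qed.

Lemma card_cdes t : #|cdes t| <= l2.
Proof.
apply: leq_trans (_ : #|row2 t| <= l2); last by rewrite card_row2.
rewrite -(card_imset _ (can_inj (@ordSK n))).
by apply/subset_leq_card/subsetP => _ /imsetP[j + ->]; rewrite cdesE => /andP[].
Qed.

Lemma path_unnested x k b :
  path (fun a b : bool => ~~ (a && b)) x (cups k ++ nseq b false).
Proof.
elim: k x => [|k IH] x /=; last by rewrite andbF IH.
by elim: b x => //= b IH x; rewrite andbF IH.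
Qed.

(** All closing letters of [t] belong to cups, so [cdes t] has [l2] elements. By compatibility a
    term [u] of the image would have all of these and [c] as well, contradicting [card_cdes]. *)
Lemma acts_unnested k b : acts_at 0 [:: false, false & cups k ++ nseq b false] None.
Proof.
set w := [:: _, _ & _]; split=> c t u tE cu.
have n1 := ltnW n_gt2.
have w_sorted : sorted (fun a b : bool => ~~ (a && b)) w := path_unnested false k b.
have t0 : c \notin row2 t by rewrite -[c]/(iter 0 (@ordS n) c) -nth_word ?tE // ltnW.
(* No two closing letters are neighbours, also across the end of the word, because its first letter
   is opening. *)
have no22 j : ordS j \in row2 t -> j \notin row2 t.
  have [a an ->] := iter_ordS_surj c j.
  rewrite -iterS; have [an1|an1] := ltnP a.+1 n; last first.
    have -> : a.+1 = n by lia.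
    by rewrite iter_ordS_n (negPf t0).
  rewrite -!nth_word // tE => w1.
  have /(sortedP false) /(_ a) := w_sorted.
  rewrite -{1}tE size_word => /(_ an1); by rewrite w1 andbT.
have sub : cdes t \subset cdes u -> False.
  move=> tu; have := card_cdes u; apply/negP; rewrite -ltnNge.
  have /proper_card : cdes t \proper cdes u.
    by apply/properP; split=> //; exists c => //; rewrite (@cdes_peak t c 0) // tE.
  apply: leq_trans; rewrite ltnS -(card_imset _ (can_inj (@ordSK n))).
  apply: leq_trans (_ : l2 <= #|row2 t|) _; first by rewrite card_row2.
  apply/subset_leq_card/subsetP => j jt; apply/imsetP; exists (ord_pred j).
    by rewrite cdesE ord_predK jt no22 // ord_predK.
  by rewrite ord_predK.
apply/eqP/negPn/negP => mut; apply: sub; apply/subsetP => j jt.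
apply/negPn/negP => ju; move/eqP: mut; apply.
have cj : c != j by apply: contraNneq ju => <-.
apply: (@compatibility c j) => //.
  apply/norP; split; apply: contraTneq jt => jE.
    rewrite jE (@cdes_peak t c 1) // tE /w /peak /=.
    by case: (k) => //; case: (b).
  by rewrite cdesE -jE (negPf t0) andbF.
by rewrite (@cdes_peak t c 0) // tE.
Qed.

(** Cups of [R] are collected one by one at the left, [k] counting those already there, until only
    opening letters remain and the word is unnested. *)
Lemma acts_unmatched R : height_from 0 R -> acts_at 0 [:: false, false & R] None.
Proof.
suff H b k : size R <= b -> height_from 0 R ->
    acts_at 0 [:: false, false & cups k ++ R] None by exact: (H (size R) 0).
elim: b R k => [|b IH] R k Rs HR.
  by case: R Rs HR => // _ _; exact: (acts_unnested k 0).
have [|R1] := boolP (true \in R); last first.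
  have -> : R = nseq (size R) false.
    apply/all_pred1P/allP => -[]; last by [].
    by rewrite (negPf R1).
  exact: acts_unnested.
case: R Rs HR => [//|[] R] Rs HR //.
rewrite inE /= => /cup_factor[p [q E]].
rewrite E; apply: slide_right_none => //.
rewrite -cupsSr; apply: IH.
  by have := congr1 size E; move: Rs; rewrite /= !size_cat /=; lia.
by rewrite -height_from_insert -E.
Qed.

End Weights.
End TableauWords.

(** * Moves as rewritings of words *)

Section Moves.
Variables n l1 l2 : nat.
Hypothesis n_gt2 : 2 < n.
Hypothesis l12n : l1 + l2 = n.
Local Notation rsyt := (rsyt n l1 l2).
Local Notation wd t c := (word (row2 t) c).
Implicit Types (s t u : rsyt) (c i j : 'I_n) (w D S r : seq bool).

(** * Cyclic intervals and the counting conditions in terms of words *)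

Lemma mem_row1 t c : (c \in row1 t) = (c \notin row2 t).
Proof. by rewrite row1E in_setC. Qed.

Lemma cdiff_iter i d : 0 < d < n -> cdiff (iter d (@ordS n) i) i = d.
Proof.
move=> /andP[d0 dn]; rewrite /cdiff val_iter_ordS; have iN := ltn_ord i.
have [idn|nid] := ltnP (i + d) n.
  by rewrite modn_small //; case: ltnP; lia.
have -> : (i + d) %% n = i + d - n by rewrite -{1}(subnK nid) modnDr modn_small //; lia.
by case: ltnP; lia.
Qed.

Lemma cdiff_modn i d : d < n -> cdiff (iter d (@ordS n) i) i %% n = d.
Proof.
case: d => [|d] dn; last by rewrite cdiff_iter // modn_small.
by rewrite /cdiff /= ltnn addnC addnK modnn.
Qed.

(** When [e.+1 = n] the interval would be the whole circle, but its start is the successor of its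
    end, so [cint] makes it empty. *)
Lemma card_setI_cint (A : {set 'I_n}) i e : e < n ->
  #|A :&: cint i (iter e (@ordS n) i)| =
  if e.+1 == n then 0 else count id (take e.+1 (word A i)).
Proof.
move=> en; rewrite /cint -iterS.
have -> : (i == iter e.+1 (@ordS n) i) = (e.+1 == n).
  apply/eqP/eqP => [E|->]; last by rewrite iter_ordS_n.
  apply/eqP/negPn/negP => ne; have : e.+1 < n by lia.
  by move/(@iter_ordS_inj _ i 0) => /(_ (leq_ltn_trans (leq0n _) en) E).
case: eqP => [_|ne]; first by rewrite finset.setI0 cards0.
rewrite -(count_word _ i) cdiff_modn //.
suff -> : word (A :&: [set x | cdiff x i %% n <= e]) i =
    take e.+1 (word A i) ++ nseq (n - e.+1) false.
  by rewrite count_cat count_nseq mul0n addn0.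
have sz : size (take e.+1 (word A i)) = e.+1 by rewrite size_takel // size_word.
apply: (eq_from_nth (x0 := false)).
  by rewrite size_cat sz size_nseq size_word; lia.
rewrite size_word => k kn; rewrite nth_word // !inE cdiff_modn // nth_cat sz ltnS.
by have [ke|ek] := leqP k e; rewrite ?andbT ?andbF ?nth_take ?nth_word ?nth_nseq ?if_same.
Qed.

Lemma iter_ord_pred k d i : k <= d ->
  iter k (@ord_pred n) (iter d (@ordS n) i) = iter (d - k) (@ordS n) i.
Proof.
elim: k => [|k IH] kd; first by rewrite subn0.
by rewrite iterS IH 1?ltnW // -(subnSK kd) iterS ordSK.
Qed.

(** The sets in the counting conditions for moves of the second kind all end two letters before [j],
    so they become suffixes of [W]. For [a = (size W).+2] the interval is empty by convention, in
    agreement with the empty suffix. *)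
Lemma count_inner s i W r a :
  wd s i = [:: true, false & W ++ [:: true, false & r]] -> 2 <= a <= (size W).+2 ->
  #|row2 s :&: cint (iter a (@ordS n) i)
      (iter 2 (@ord_pred n) (iter (size W).+3 (@ordS n) i))| =
  count id (drop (a - 2) W).
Proof.
move=> E /andP[a2 aW].
have sz : n = (size W + size r).+4.
  by rewrite -(size_word (row2 s) i) E /= size_cat /=; lia.
rewrite iter_ord_pred // !subSS subn0.
have [aeq|alt] := eqVneq a (size W).+2.
  rewrite aeq /cint -iterS eqxx finset.setI0 cards0 subSS subSS subn0 drop_size //.
have -> : (size W).+1 = (size W).+1 - a + a by lia.
rewrite iterD card_setI_cint; last by lia.
case: eqP => [|_]; first by lia.
rewrite word_rot; last by lia.
rewrite /rot E; case: a a2 aW alt => [|[|a]] //= _ aW alt.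
rewrite drop_cat; have aW' : a < size W by lia.
rewrite aW' -catA take_cat size_drop.
have -> : ((size W).+1 - a.+2).+1 < size W - a = false by lia.
have -> : ((size W).+1 - a.+2).+1 - (size W - a) = 0 by lia.
by rewrite take0 cats0 subSS subSS subn0.
Qed.

(** The right side is the word form of the two counting conditions. They bound only suffixes of even
    length; for odd length the final [true] makes up for the extra letter. *)
Lemma dyck_nested W : dyck (false :: rcons W true) <->
  size W = (count id W).*2 /\
  all (fun k => k <= count id (drop (size W - k.*2) W)) (iota 1 (size W)./2).
Proof.
have cW k : count id (drop k (rcons W true)) = (k <= size W) + count id (drop k W).
  rewrite -cats1 drop_cat; case: ltngtP => [kW|kW|->] /=.
  - by rewrite count_cat /=; lia.
  - by rewrite [drop k W]drop_oversize ?(ltnW kW) //; case: (k - _) (subn_gt0 (size W) k) => //; lia.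
  - by rewrite subnn drop_size.
split=> [dW|[szW /allP H]].
  have := dyck_size dW; rewrite /= size_rcons -(drop0 (rcons _ _)) cW drop0 => sz.
  split; first by lia.
  apply/allP => k; rewrite mem_iota => k1.
  have := dyck_suffix (size W - k.*2).+1 dW; rewrite /= cW size_drop size_rcons.
  by rewrite leq_subr; lia.
apply: dyck_of_suffixes => [|[|k]]; rewrite ?drop0 /=.
- by rewrite size_rcons -(drop0 (rcons _ _)) cW drop0; lia.
- by rewrite size_rcons -(drop0 (rcons _ _)) cW drop0; lia.
rewrite cW size_drop size_rcons.
have [kW|kW] := leqP k (size W); last by lia.
pose j := (size W - k)./2.
have jW : j <= count id (drop (size W - j.*2) W).
  have [->//|j0] := posnP j; apply: H; rewrite mem_iota; rewrite /j in j0 *; lia.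
have : count id (drop (size W - j.*2) W) <= count id (drop k W).
  have -> : size W - j.*2 = (size W - j.*2 - k) + k by rewrite /j; lia.
  by rewrite -drop_drop; apply: leq_count_subseq; exact: drop_subseq.
by move: jW; rewrite /j; lia.
Qed.

Lemma dyck_ends D : dyck D -> D = [::] \/ exists W, D = false :: rcons W true.
Proof.
case: D => [|b D] dD; [by left | right].
have := dyck_suffix 1 dD; have := dyck_size dD; rewrite /= drop0.
case: b dD => dD /=; first by lia.
case/lastP: D dD => [|W b] dD //= _ _; exists W.
have := dyck_suffix (size W).+1 dD; rewrite /= -!cats1 drop_size_cat //=.
by case: (b).
Qed.

Section SecondMoveWord.
Variables (s : rsyt) (i : 'I_n) (D r : seq bool).
Hypothesis wE : wd s i = true :: D ++ false :: r.
Let j := iter (size D).+1 (@ordS n) i.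

Lemma second_move_size : n = size D + size r + 2.
Proof. by rewrite -(size_word (row2 s) i) wE /= size_cat /=; lia. Qed.

Lemma second_move_i : i \in row2 s.
Proof. by rewrite -[i]/(iter 0 (@ordS n) i) -nth_word ?wE //; lia. Qed.

Lemma second_move_j : j \in row1 s.
Proof.
have := second_move_size => sz.
by rewrite mem_row1 -nth_word ?wE /= ?nth_cat ?ltnn ?subnn //; lia.
Qed.

Lemma second_move_cdiff : cdiff j i = (size D).+1.
Proof. by rewrite cdiff_iter //; have := second_move_size; lia. Qed.

Lemma second_move_not_next : (i != ordS j) = (r != [::]).
Proof.
have sz := second_move_size.
rewrite /j -iterS; congr (~~ _); apply/eqP/eqP => [ij|r0].
  have [//|rsz] : r = [::] \/ 0 < size r by case: (r); [left|right].
  suff : 0 = (size D).+2 by [].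
  by apply: (@iter_ordS_inj _ i); [lia|lia|exact: ij].
have -> : (size D).+2 = n by rewrite sz r0 /=; lia.
by rewrite iter_ordS_n.
Qed.

Lemma second_move_pred : r != [::] -> (ord_pred i \in row1 s) = ~~ last true r.
Proof.
move=> r0; have sz := second_move_size.
have -> : ord_pred i = iter n.-1 (@ordS n) i.
  by rewrite -[RHS]ordSK -iterS prednK ?iter_ordS_n //; lia.
rewrite mem_row1 -nth_word; last by lia.
have -> : n.-1 = (size (wd s i)).-1 by rewrite size_word.
rewrite nth_last wE /= last_cat /=.
by case: r r0.
Qed.

Lemma second_move_succ : r != [::] -> (ordS j \in row2 s) = head false r.
Proof.
move=> r0; have := second_move_size => sz.
have r1 : 0 < size r by case: r r0.
rewrite /j -iterS -nth_word; last by lia.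
by rewrite wE /= nth_cat ltnNge leqnSn /= subSnn /=; case: r r0.
Qed.

End SecondMoveWord.

Lemma inner_index d k : 0 < k < 1 + d./2 ->
  [/\ d.+3 - (1 + 2 * k) = d - k.*2 + 2, 1 + 2 * k <= d.+3 & 2 <= d - k.*2 + 2 <= d.+2].
Proof. by move=> ?; split; lia. Qed.

(** Read from [i], [D] is the stretch up to [j] and [r] the rest of the circle. Parity, the letters
    next to [i] and [j] inside, and the counts say that [D] is Dyck; the last two conditions express
    that [i] does not follow [j] and that a letter outside suits. *)
Lemma second_move_atP i j s : reflect
  (exists D r, [/\ wd s i = true :: D ++ false :: r, j = iter (size D).+1 (@ordS n) i,
     dyck D, r != [::] & ~~ last true r || head false r])
  (second_move_at i j s).
Proof.
apply: (iffP idP) => [|[D [r [wE jE dD r0 rlast]]]].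
  case/and5P => /and3P[i2 j1 ij] dodd /andP[iS jP] ends /andP[Hd He].
  have [d dn jE] := iter_ordS_surj i j.
  case: d => [|d] in dn jE; first by rewrite jE /= mem_row1 i2 in j1.
  have [D [r [wE Dd]]] : exists D r, wd s i = true :: D ++ false :: r /\ size D = d.
    clear ij dodd iS jP ends Hd He; have sw := size_word (row2 s) i.
    have w0 : nth false (wd s i) 0 by rewrite nth_word ?(leq_ltn_trans _ dn).
    have wd1 : nth false (wd s i) d.+1 = false.
      by rewrite nth_word // -jE; apply/negbTE; rewrite -mem_row1.
    case: (wd s i) sw w0 wd1 => [|[] w] //= sw _ wd1.
    exists (take d w), (drop d.+1 w); rewrite size_takel; last by lia.
    by rewrite -wd1 -drop_nth ?cat_take_drop //; lia.
  subst d; exists D, r; rewrite jE in ij j1 dodd iS jP ends Hd He *.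
  rewrite (second_move_not_next wE) in ij.
  rewrite (second_move_pred wE ij) (second_move_succ wE ij) in ends.
  split=> //; rewrite (second_move_cdiff wE) in dodd Hd He.
  clear i2 j1 ij ends; clear jE.
  case: D => [|b D] in wE jP dodd iS Hd He dn *; first exact: dyck_nil.
  have bf : b = false.
    move: iS; rewrite mem_row1 -[ordS i]/(iter 1 (@ordS n) i) -nth_word ?(ltnW n_gt2) //.
    by rewrite wE /=; case: (b).
  (* A one-letter [D] contradicts the parity of [cdiff j i]. *)
  subst b; case/lastP: D => [|W b] in wE jP dodd iS Hd He dn *; first by [].
  have bt : b = true.
    move: jP; rewrite -[ord_pred _]/(iter 1 (@ord_pred n) _) iter_ord_pred //.
    rewrite -nth_word; last by lia.
    by rewrite wE /= size_rcons ?subn1 ?subn0 /= -cats1 -?catA /= nth_cat ltnn subnn.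
  subst b; rewrite -cats1 /= -catA /= in wE; rewrite /= size_rcons in Hd He dodd.
  apply/dyck_nested; have Wodd : ~~ odd (size W) by move: dodd; rewrite /= negbK.
  have cW := count_inner wE.
  have dW : (size W).+3 < n by move: dn; rewrite /= size_rcons.
  have Hj : iter (size W).+3 (@ordS n) i != ordS i.
    apply/eqP => /(@iter_ordS_inj _ i (size W).+3 1); lia.
  rewrite !subSS subn0 in Hd He.
  have cW2 := cW 2; rewrite /= subnn drop0 in cW2; rewrite /= in Hj.
  rewrite Hj /= cW2 // in He; move/eqP: He => He.
  split; first by rewrite He; lia.
  apply/allP => k kW; have /allP /(_ k kW) := Hd.
  rewrite mem_iota in kW.
  have [kE k3 k2] := inner_index kW.
  by have := cW _ k2; rewrite addnK => <-; rewrite -kE -iter_ord_pred.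
have iE := second_move_i wE; have j1 := second_move_j wE.
have n1 := ltnW n_gt2.
rewrite /second_move_at jE iE j1 (second_move_not_next wE) r0 !andTb.
rewrite (second_move_pred wE r0) (second_move_succ wE r0) rlast (second_move_cdiff wE).
case: (dyck_ends dD) => [D0|[W DW]].
  subst D; rewrite /= eqxx /= andbT.
  by rewrite j1 /= [ord_pred _]ordSK iE.
have Dsz : size D = (size W).+2 by rewrite DW /= size_rcons.
have wE' : wd s i = [:: true, false & W ++ [:: true, false & r]].
  by rewrite wE DW -cats1 /= -catA.
have sz : n = (size W + size r).+4.
  by rewrite -(size_word (row2 s) i) wE' /= size_cat /=; lia.
rewrite DW in dD; have [szW allW] := (dyck_nested W).1 dD.
have cW := count_inner wE'.
have dodd : odd (size W).+3 by rewrite /= negbK szW odd_double.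
have iS : ordS i \in row1 s.
  by rewrite mem_row1 -[ordS i]/(iter 1 (@ordS n) i) -nth_word // wE'.
have jP : ord_pred (iter (size W).+3 (@ordS n) i) \in row2 s.
  rewrite [iter _ _ _]iterS ordSK -nth_word; last by lia.
  by rewrite wE' /= nth_cat ltnn subnn.
rewrite Dsz dodd iS jP !andTb !subSS subn0; apply/andP; split.
  apply/allP => k kW; have /allP /(_ k kW) := allW.
  rewrite mem_iota in kW.
  have [kE k3 k2] := inner_index kW.
  by rewrite (iter_ord_pred _ k3) kE cW // addnK.
by rewrite (cW 2) // subnn drop0 szW doubleK eqxx implybT.
Qed.

(** The moves that destroy the descent [c], read from [c]: a move of the first kind, one of the
    second kind with [i = ordS c], and one of the second kind with [j = c]. *)
Definition move_words (s t : rsyt) c : Prop :=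
  [\/ exists R, wd s c = [:: false, true & R] /\ wd t c = [:: true, false & R],
      exists D S, [/\ dyck D, wd s c = [:: false, true & D ++ false :: S] &
        wd t c = [:: false, false & D ++ true :: S]]
    | exists D S, [/\ dyck D, wd s c = [:: false, true & S ++ true :: D] &
        wd t c = [:: true, true & S ++ false :: D]]].

Lemma move_of_words s t c : move_words s t c -> first_move s t || second_move s t.
Proof.
case=> [[R [sE tE]]|[D [S [dD sE tE]]]|[D [S [dD sE tE]]]]; apply/orP.
- left; apply/existsP; exists c.
  rewrite (interchanged_word (B := [::]) t sE) tE eqxx andbT mem_row1.
  have n1 := ltnW n_gt2; have := @nth_word _ (row2 s) c 0 (ltnW n1).
  by have := @nth_word _ (row2 s) c 1 n1; rewrite sE /= => <- <-.
- have siE := @word_shift _ _ _ [:: false] _ sE.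
  have tiE := @word_shift _ _ _ [:: false] _ tE.
  right; apply/existsP; exists (ordS c); apply/existsP.
  exists (iter (size D).+1 (@ordS n) (ordS c)); apply/andP; split.
    apply/second_move_atP; exists D, (rcons S false).
    split=> //; first by rewrite siE /= -catA cats1.
      by case: (S).
    by rewrite last_rcons.
  have -> := @interchanged_word _ _ _ s t (ordS c) true D false (S ++ [:: false]).
    by rewrite tiE /= -catA.
  by rewrite siE /= -catA.
have siE := @word_shift _ _ _ [:: false, true & S] (true :: D) sE.
have tiE := @word_shift _ _ _ [:: true, true & S] (false :: D) tE.
right; apply/existsP; exists (iter (size S).+2 (@ordS n) c); apply/existsP; exists c.
have cE : c = iter (size D).+1 (@ordS n) (iter (size S).+2 (@ordS n) c).
  rewrite -iterD; have -> : (size D).+1 + (size S).+2 = n; last by rewrite iter_ordS_n.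
  by rewrite -(size_word (row2 s) c) sE /= size_cat /=; lia.
apply/andP; split.
  by apply/second_move_atP; exists D, (true :: S); split; rewrite ?orbT.
have := @interchanged_word _ _ _ s t _ true D false (true :: S) siE.
by rewrite -cE tiE eqxx.
Qed.

Lemma interchanged_cdes i j s t c : interchanged i j s t ->
  c \in cdes s -> c \notin cdes t ->
  ((c == i) || (c == j)) && (c \notin row2 s) ||
    ((ordS c == i) || (ordS c == j)) && (ordS c \in row2 s).
Proof.
rewrite interchangedP !cdesE => /eqP -> /andP[c1 c2].
rewrite !mem_imset_tperm c1 c2 !andbT.
apply: contraNT; rewrite negb_or !negb_or => /andP[/andP[ci cj] /andP[di dj]].
by rewrite !tpermD 1?eq_sym // c1 c2.
Qed.

Lemma words_of_move s t c : c \in cdes s -> c \notin cdes t ->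
  first_move s t || second_move s t -> move_words s t c.
Proof.
move=> cs ct /orP[/existsP[i /and3P[i1 i2 sw]]|/existsP[i /existsP[j /andP[/second_move_atP]]]].
  have n1 := ltnW n_gt2.
  have s0 : nth false (wd s i) 0 = false.
    by rewrite nth_word ?(ltnW n1) //; apply/negbTE; rewrite -mem_row1.
  have s1 : nth false (wd s i) 1 = true by rewrite nth_word.
  have [R sE] : exists R, wd s i = [:: false, true & R].
    case: (wd s i) (size_word (row2 s) i) s0 s1 => [|a [|b R]] /=.
    - by move=> *; lia.
    - by move=> *; lia.
    by move=> _ -> ->; exists R.
  have ci : c = i.
    have := interchanged_cdes sw cs ct; rewrite mem_row1 in i1.
    case/orP=> /andP[/orP[] /eqP cE c2]; first exact: cE.
    - by rewrite cE i2 in c2.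
    - by rewrite cE (negPf i1) in c2.
    - by rewrite -[c]ordSK cE ordSK.
  constructor 1; exists R; rewrite ci; split=> //.
  by move: sw; rewrite (interchanged_word (B := [::]) t sE) => /eqP.
move=> [D [r [sE jE dD r0 _]]] sw; rewrite jE in sw.
have tE : wd t i = false :: D ++ true :: r.
  by move: sw; rewrite (interchanged_word t sE) => /eqP.
have i2 := second_move_i sE; have := second_move_j sE; rewrite mem_row1 => j1.
have := interchanged_cdes sw cs ct.
case/orP=> /andP[/orP[] /eqP cE c2].
- by rewrite cE i2 in c2.
(* Here [c = j], and the descent at [j] forces the letter after [j] to be closing. *)
- have sjE := @word_shift _ _ _ (true :: D) (false :: r) sE.
  have tjE := @word_shift _ _ _ (false :: D) (true :: r) tE.
  case: r r0 sE tE sjE tjE => // b S _ sE tE sjE tjE.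
  have b1 : b = true.
    move: cs; rewrite cE cdesE => /andP[_].
    rewrite -[ordS _]/(iter 1 (@ordS n) _) -nth_word ?(ltnW n_gt2) //.
    by rewrite sjE.
  by subst b; constructor 3; exists D, S; rewrite cE sjE tjE.
(* Here [c] is the predecessor of [i], so it is the last letter of [r], and the descent forces it to
   be opening. *)
- case/lastP: r r0 sE tE => // S b _ sE tE.
  have spE := @word_shift _ _ _ (true :: D ++ false :: S) [:: b].
  have tpE := @word_shift _ _ _ (false :: D ++ true :: S) [:: b].
  have sz : n = (size D + size S).+3.
    by rewrite -(size_word (row2 s) i) sE /= size_cat /= size_rcons; lia.
  have cE' : c = iter (size D + size S).+2 (@ordS n) i.
    rewrite -[c]ordSK cE -[RHS]ordSK -iterS -sz iter_ordS_n //.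
  have sE' : wd s c = b :: true :: D ++ false :: S.
    have := spE n (row2 s) i; rewrite sE -cats1 /= -catA => /(_ erefl) <-.
    by rewrite cE' size_cat /= addnS.
  have tE' : wd t c = b :: false :: D ++ true :: S.
    have := tpE n (row2 t) i; rewrite tE -cats1 /= -catA => /(_ erefl) <-.
    by rewrite cE' size_cat /= addnS.
  have b0 : b = false.
    move: cs; rewrite cdesE => /andP[+ _].
    by rewrite -[c]/(iter 0 (@ordS n) c) -nth_word ?sE' /=; [case: (b)|lia].
  by subst b; constructor 2; exists D, S.
by rewrite cE (negPf j1) in c2.
Qed.

End Moves.

(** * Comparison with the move graph *)

Section MoveWeights.
Variables n l1 l2 : nat.
Hypotheses (n_gt2 : 2 < n) (l12n : l1 + l2 = n) (l2_lt : l2 < l1).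
Local Notation rsyt := (rsyt n l1 l2).
Local Notation wd t c := (word (row2 t) c).
Implicit Types (s t : rsyt) (c i j : 'I_n).

(** The word of [t] from [c] starts with [true] or with [false, false]. In each case the matching
    determines the only [s] of nonzero weight, and these are the three shapes of [move_words]. *)
Lemma acts_move_words (m : rsyt -> rsyt -> nat) s t c :
  (forall D S y, dyck D -> acts_at m 0 [:: true, y & S ++ false :: D]
    (Some [:: false, true & S ++ y :: D])) ->
  (forall D S x, dyck D -> acts_at m 0 [:: x, false & D ++ true :: S]
    (Some [:: false, true & D ++ x :: S])) ->
  (forall R, height_from 0 R -> acts_at m 0 [:: false, false & R] None) ->
  c \in cdes s -> c \notin cdes t ->
  m s t = (first_move s t || second_move s t).
Proof.
move=> matchL matchR unmatched cs ct.
have n1 := ltnW n_gt2.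
have one_if v w : wd t c = v -> wd s c = w -> acts_at m 0 v (Some w) -> m s t = 1.
  by move=> tE sE A; rewrite (acts_atP A tE cs) sE eqxx.
(* This uses [l2 < l1]: a closing letter at [c] always has a partner when one continues around the
   circle. *)
have closed R : size R + 2 = n -> count id R < l2 ->
    exists S D, R = S ++ false :: D /\ dyck D.
  move=> Rn R2; apply: last_unmatched.
  by have := count_predC id R; rewrite -[count (predC id) R]/(count negb R); lia.
have szt := size_word (row2 t) c; have cnt := count_wd t c.
have [mv|nmv] := boolP (first_move s t || second_move s t).
  have [[R [sE tE]]|[D [S [dD sE tE]]]|[D [S [dD sE tE]]]] :=
    words_of_move n_gt2 l12n cs ct mv.
  - have [||S [D [RE dD]]] := closed R.
    + by move: szt; rewrite tE /=; lia.
    + by move: cnt; rewrite tE /=; lia.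
    by apply: one_if tE sE _; rewrite RE; exact: matchL.
  - by apply: one_if tE sE _; exact: matchR.
  - by apply: one_if tE sE _; exact: matchL.
apply/eqP; apply: contraNT nmv => ms0.
apply: (@move_of_words _ _ _ n_gt2 l12n s t c).
have s_eq v w : wd t c = v -> acts_at m 0 v (Some w) -> wd s c = w.
  move=> tE A; apply/eqP; apply: contraNT ms0 => ne; rewrite (acts_atP A tE cs).
  have /negPf -> // : Some (wd s c) != Some w by apply: contra ne => /eqP[->].
have ctw : ~~ peak (wd t c) 0 by rewrite -(@cdes_peak _ _ _ t c 0).
case tE : {-}(wd t c) szt cnt ctw => [|[] [|b R]]; rewrite tE /= => szt cnt ctw //; try by lia.
  have [||S [D [RE dD]]] := closed R; [by lia | by lia | subst R].
  have sE := s_eq _ _ tE (matchL D S b dD).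
  case: b tE sE {szt cnt ctw} => tE sE; first by constructor 3; exists D, S.
  by constructor 1; exists (S ++ false :: D).
case: b tE szt cnt ctw => // tE szt cnt _.
case: (first_return 0 R) => [[D [S [RE HD]]]|HR].
  subst R; constructor 2; exists D, S.
  have dD := dyck_height HD.
  by split=> //; apply: s_eq tE _; exact: matchR.
by have := acts_atP (unmatched R HR) tE cs; move/eqP: ms0.
Qed.

(** Every move destroys a descent: at [i] for the first kind, at [ord_pred i] or [j] for the second.
    Hence the move graph also vanishes where reducedness forces weight [0]. *)
Lemma move_cdes s t : first_move s t || second_move s t -> ~~ (cdes s \subset cdes t).
Proof.
have no_sub c : c \in cdes s -> c \notin cdes t -> ~~ (cdes s \subset cdes t).
  by move=> cs ct; apply: contra ct => /subsetP; apply.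
case/orP=> [/existsP[i /and3P[i1 i2 sw]]|/existsP[i /existsP[j /andP[sm sw]]]].
  apply: (no_sub i); first by rewrite inE i1.
  move: sw; rewrite interchangedP => /eqP tE.
  by rewrite cdesE tE mem_imset_tperm tpermL i2.
have /and5P[/and3P[i2 j1 _] _ _ ends _] := sm.
rewrite mem_row1 // in j1.
move: sw; rewrite interchangedP => /eqP tE.
case/orP: ends => [ip|js].
  apply: (no_sub (ord_pred i)); first by rewrite inE ip ord_predK.
  by rewrite cdesE ord_predK tE !mem_imset_tperm tpermL (negPf j1) andbF.
apply: (no_sub j); first by rewrite cdesE j1.
by rewrite cdesE tE mem_imset_tperm tpermR i2.
Qed.

End MoveWeights.

Section Isomorphisms.
Variable I : finType.

Lemma lgraph_iso_sym (G H : lgraph I) : lgraph_iso G H -> lgraph_iso H G.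
Proof.
case=> f [[g fK gK] fw ft]; exists g; split; first by exists f.
- by move=> u v; rewrite -fw !gK.
- by move=> u; rewrite -ft gK.
Qed.

Lemma lgraph_iso_trans (G H K : lgraph I) :
  lgraph_iso G H -> lgraph_iso H K -> lgraph_iso G K.
Proof.
case=> f [f_bij fw ft] [g [g_bij gw gt]]; exists (g \o f); split.
- exact: bij_comp.
- by move=> u v /=; rewrite gw fw.
- by move=> u /=; rewrite gt ft.
Qed.

End Isomorphisms.

Lemma affA_cox_adjacent n (i j : 'I_n) : i != j ->
  affA_cox i j = if adjacent i j then 3 else 2.
Proof. by move=> /negPf ij; rewrite /affA_cox /adjacent ij. Qed.

(** The isomorphism is the given one on the simple underlying graph; what has to be shown is that
    all weights, not only those of simple edges, are determined. *)
Lemma wgraph_iso_move_graph n l1 l2 (G : lgraph 'I_n) :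
  2 < n -> l1 + l2 = n -> l2 < l1 ->
  is_wgraph (@affA_cox n) G -> reduced G -> nb_admissible G ->
  lgraph_iso (simple_graph G) (knuth_graph n l1 l2) ->
  lgraph_iso G (move_graph n l1 l2).
Proof.
move=> n_gt2 l12n l2_lt GW Gred [Gnat _] isoG.
have [f [[g fK gK] f_weight f_tau]] : exists f : vertex G -> rsyt n l1 l2,
    [/\ bijective f, forall u v, simple_weight u v = (knuth_move (f u) (f v))%:R%R
      & forall u, cdes (f u) = tau u].
  by case: isoG => f [f_bij f_weight f_tau]; exists f; split=> // u v; exact/esym/f_weight.
have g_bij : bijective g by exists f.
(* Admissibility gives each weight as a natural number only existentially, so choice is needed to
   obtain a function. *)
pose m s t := sval (cid (Gnat (g s) (g t))).
have weightE s t : weight (g s) (g t) = (m s t)%:R%R by rewrite /m; case: cid => k /= ->.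
have tauE s : tau (g s) = cdes s by rewrite -f_tau gK.
have coxE (i j : 'I_n) : i != j -> adjacent i j -> affA_cox i j = 3.
  by move=> ij adj; rewrite affA_cox_adjacent // adj.
have coxE2 (i j : 'I_n) : i != j -> ~~ adjacent i j -> affA_cox i j = 2.
  by move=> ij /negPf adj; rewrite affA_cox_adjacent // adj.
have tau_adj i j s : affA_cox i j = 3 -> ~~ ((i \in tau (g s)) && (j \in tau (g s))).
  rewrite /affA_cox; case: eqP => // _; case: ifP => // adj _.
  rewrite !tauE !cdesE; apply/negP => /andP[/andP[i1 i2] /andP[j1 j2]].
  by case/orP: adj => /eqP E; [rewrite -E (negPf j1) in i2|rewrite -E (negPf i1) in j2].
have bond i j s t : i != j -> adjacent i j -> j \in cdes s -> j \in cdes t ->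
    \sum_(a | i \in cdes a) m s a * m a t = (s == t).
  move=> ij adj js jt; rewrite -(wgraph_bond g_bij weightE GW tau_adj ij (coxE _ _ ij adj)) ?tauE //.
  by apply: eq_bigl => a; rewrite tauE.
have compat i j s t : i != j -> ~~ adjacent i j ->
    i \in cdes s -> j \notin cdes s -> i \notin cdes t -> j \in cdes t -> m s t = 0.
  move=> ij adj; rewrite -!tauE.
  exact: (wgraph_compatibility g_bij weightE GW ij (coxE2 _ _ ij adj)).
have polygon i j s t : i != j -> ~~ adjacent i j ->
    i \in cdes s -> j \in cdes s -> i \notin cdes t -> j \notin cdes t ->
    \sum_(a | (i \in cdes a) && (j \notin cdes a)) m s a * m a t =
    \sum_(a | (j \in cdes a) && (i \notin cdes a)) m s a * m a t.
  move=> ij adj; rewrite -!tauE => si sj ti tj.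
  have ji : j != i by rewrite eq_sym.
  have adj' : ~~ adjacent j i by rewrite /adjacent orbC.
  under eq_bigl do rewrite -!tauE; under [RHS]eq_bigl do rewrite -!tauE.
  exact: (wgraph_polygon g_bij weightE GW ij (coxE2 _ _ ij adj) (coxE2 _ _ ji adj')).
have simple_edge s t : m s t = 1 -> m t s = 1 -> exists i, interchanged i (ordS i) s t.
  move=> st ts; have := f_weight (g s) (g t).
  rewrite !gK /simple_weight !weightE st ts eqxx.
  case: (boolP (knuth_move s t)) => [/and3P[_ _ /existsP[i sw]] _|_ /eqP]; first by exists i.
  by rewrite mulr0n oner_eq0.
suff mE s t : m s t = (first_move s t || second_move s t).
  exists (f : vertex G -> vertex (move_graph n l1 l2)); split.
  - by exists g.
  - by move=> u v; rewrite -[u in RHS]fK -[v in RHS]fK weightE mE.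
  - exact: f_tau.
(* If [cdes s] is included in [cdes t], both sides are [0]; otherwise a lost descent [c] serves as
   base point for reading words. *)
have [sub|/subsetPn[c cs ct]] := boolP (cdes s \subset cdes t).
  have m0 : m s t = 0.
    by apply: laurent_natr_inj; rewrite -weightE Gred // !tauE.
  rewrite m0; case: (boolP (_ || _)) => // /move_cdes.
  by rewrite sub.
apply: (@acts_move_words _ _ _ n_gt2 l12n l2_lt m s t c) => //.
- by move=> D S y; exact: acts_match_left.
- by move=> D S x; exact: acts_match_right.
- by move=> R; exact: acts_unmatched.
Qed.

Theorem theorem8p6 (n l1 l2 : nat) (hn : 3 <= n) (hsum : l1 + l2 = n)
    (hlt : l2 < l1) (hl2 : 1 <= l2) (G G' : lgraph 'I_n)
    (hWG : is_wgraph (@affA_cox n) G) (hWG' : is_wgraph (@affA_cox n) G')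
    (hrG : reduced G) (hrG' : reduced G')
    (haG : nb_admissible G) (haG' : nb_admissible G')
    (hUG : lgraph_iso (simple_graph G) (knuth_graph n l1 l2))
    (hUG' : lgraph_iso (simple_graph G') (knuth_graph n l1 l2)) :
  [/\ lgraph_iso G G',
      lgraph_iso G (move_graph n l1 l2)
    & lgraph_iso G' (move_graph n l1 l2)].
Proof.
have isoG := wgraph_iso_move_graph hn hsum hlt hWG hrG haG hUG.
have isoG' := wgraph_iso_move_graph hn hsum hlt hWG' hrG' haG' hUG'.
by split=> //; exact: lgraph_iso_trans isoG (lgraph_iso_sym isoG').
Qed.
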